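(* Let $b\ge 1$ be an integer and $c\ge 0$ a real number, both fixed. There is a constant $M>0$, depending only on $b$ and $c$ (in particular independent of $n$), such that for every $n\ge 2$ the following holds. Let $\mathcal{F}$ be the hypothesis space of the variational $n$-qubit circuit $F=(B_nB_{n-1}\cdots B_2)^{\lceil M n^c\rceil}$. Then for any $n$-qubit circuit $C\in\mathcal{C}$ (i.e. consisting of at most $n^c$ unitary gates, each acting on at most $b$ qubits), there exists a hypothesis function $f_h\in\mathcal{F}$ such that $f_h(x)=f_C(x)$ for all $x\in\mathcal{X}$. Here pure states are identified when they differ by a global phase.
   Context: $\mathcal{X}=\mathcal{Y}$ is the set of all $n$-qubit pure states, i.e. unit vectors in $(\mathbb{C}^2)^{\otimes n}$ up to global phase; for $x\in\mathcal{X}$ write $|\psi(x)\rangle$ for a representing unit vector. Concept class: $\mathcal{C}$ is the set of all $n$-qubit quantum circuits (products of gates) with at most $n^c$ unitary gates, each gate being an arbitrary unitary acting on some set of at most $b$ of the $n$ qubits (tensored with the identity on the others). Each $C\in\mathcal{C}$ defines $f_C:\mathcal{X}\to\mathcal{Y}$, $|\psi(f_C(x))\rangle=C|\psi(x)\rangle$. Variational circuit: $H$ is the Hadamard gate, $X$ the Pauli $X$ matrix, $R_x(\theta)=e^{-i\theta X/2}$, and $\mathrm{CNOT}_{1i}$ is the controlled-NOT with control qubit $1$ and target qubit $i$. A level-1 block is a single-qubit gate $L=HR_x(\beta)HR_x(\gamma)HR_x(\delta)H$ with free parameters $\beta,\gamma,\delta\in[0,2\pi)$. For $i=2,\dots,n$,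 a level-2 block is $$B_i=\mathrm{CNOT}_{1i}\,(L^{(3)}_1\otimes L^{(4)}_i)\,\mathrm{CNOT}_{1i}\,(L^{(1)}_1\otimes L^{(2)}_i),$$ where $L^{(k)}_j$ denotes a level-1 block acting on qubit $j$, and the four level-1 blocks have independent parameters. A layer is $B_nB_{n-1}\cdots B_2$, and a power $(B_n\cdots B_2)^d$ denotes a product of $d$ layers in which every block occurrence has its own independent parameters. The hypothesis space $\mathcal{F}$ is the set of all functions $f_h:\mathcal{X}\to\mathcal{Y}$ of the form $|\psi(f_h(x))\rangle=F(\boldsymbol\theta)|\psi(x)\rangle$, where $\boldsymbol\theta$ ranges over all assignments of values in $[0,2\pi)$ to the parameters of $F$. *)

(* Defs.v *)
From HB Require Import structures.
From mathcomp Require Import all_boot all_order all_algebra.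
From mathcomp Require Import all_classical all_reals all_analysis.
From mathcomp Require Import complex ring.

Set Implicit Arguments.
Unset Strict Implicit.
Unset Printing Implicit Defensive.

Import Order.TTheory GRing.Theory Num.Theory ComplexField.
Import numFieldNormedType.Exports.
Local Open Scope complex_scope.
Local Open Scope classical_set_scope.
Local Open Scope ring_scope.
Local Open Scope sesquilinear_scope.
Local Open Scope quotient_scope.

(* A matrix supported on pairs of strings with the same "rest", given on these
   by a unitary matrix on the local part W, is unitary. *)
Lemma local_unitary (R : realType) (B W : finType) (loc : B -> W) (upd : B -> W -> B)
    (eqv : rel B) (M : W -> W -> R[i]) (A : 'M[R[i]]_#|B|) :
    (forall x w, loc (upd x w) = w) ->
    (forall x z, eqv x z = (z == upd x (loc z))) ->
    (forall x, eqv x x) ->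
    (forall x y z, eqv x z -> eqv y z = eqv x y) ->
    (forall a b, \sum_w M a w * (M b w)^* = (a == b)%:R) ->
    (forall r s, A r s = if eqv (enum_val r) (enum_val s)
       then M (loc (enum_val r)) (loc (enum_val s)) else 0) ->
  A \is unitarymx.
Proof.
move=> updK eqvE eqvxx eqvT MU AE; apply/unitarymxP/matrixP => r s.
rewrite !mxE; set x := enum_val r; set y := enum_val s.
transitivity (\sum_(z | eqv x z) (if eqv x y
    then M (loc x) (loc z) * (M (loc y) (loc z))^* else 0)).
  rewrite (reindex_onto (@enum_rank B) enum_val) /=; last first.
    by move=> i _; rewrite enum_valK.
  rewrite [RHS]big_mkcond; apply: eq_big => [z|z _]; first by rewrite enum_rankK eqxx.
  rewrite !mxE !AE !enum_rankK -/x -/y.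
  have [xz|_] := boolP (eqv x z); last by rewrite mul0r.
  by rewrite (eqvT _ _ _ xz); case: ifP => //; rewrite rmorph0 mulr0.
rewrite (reindex_onto (upd x) loc) /=; last first.
  by move=> z; rewrite eqvE => /eqP <-.
under eq_bigl do rewrite eqvE !updK !eqxx.
under eq_bigr do rewrite updK.
have [xy|nxy] := boolP (eqv x y).
  rewrite MU; congr (_%:R); congr nat_of_bool.
  apply/eqP/eqP => [lxy|rs]; last by rewrite /x rs.
  apply: enum_val_inj; rewrite -/x -/y.
  move: (xy) (eqvxx x); rewrite !eqvE => /eqP -> /eqP {1}->.
  by rewrite lxy.
rewrite big1 //; case: eqP => // rs.
by rewrite /x /y rs eqvxx in nxy.
Qed.

(* A register whose qubits are labelled by the finite type Q has the
   computational basis {ffun Q -> 'I_2} (bit strings); vectors and operators on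
   (C^2)^{(x) Q} are matrices whose indices r stand for the basis string
   enum_val r. *)
Notation qvec R Q := 'cV[R[i]]_#|{ffun Q -> 'I_2}|.
Notation qop R Q := 'M[R[i]]_#|{ffun Q -> 'I_2}|.

Section Registers.
Variables (R : realType) (Q : finType).
Implicit Types (x y : {ffun Q -> 'I_2}) (S : {set Q}).

Definition restrict_bits S x : {ffun {q | q \in S} -> 'I_2} :=
  [ffun q => x (val q)].

Definition agree_off S x y := [forall q, (q \notin S) ==> (x q == y q)].

(* U (x) Id, with U acting on the qubits in S. *)
Definition extend S (U : qop R {q | q \in S}) : qop R Q :=
  \matrix_(r, s)
    let x := enum_val r in let y := enum_val s in
    if agree_off S x y
    then U (enum_rank (restrict_bits S x)) (enum_rank (restrict_bits S y))
    else 0.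

(* A (x) Id, with the 2 x 2 matrix A acting on qubit q. *)
Definition on_qubit (q : Q) (A : 'M[R[i]]_2) : qop R Q :=
  \matrix_(r, s)
    let x := enum_val r in let y := enum_val s in
    if agree_off [set q] x y then A (x q) (y q) else 0.

(* The addition of 'I_2 is addition modulo 2. *)
Definition cnot_bits (c t : Q) y : {ffun Q -> 'I_2} :=
  [ffun q => if q == t then y t + y c else y q].

Definition CNOT (c t : Q) : qop R Q :=
  \matrix_(r, s) (enum_val r == cnot_bits c t (enum_val s))%:R.

Lemma agree_offP S x y :
  reflect (forall q, q \notin S -> x q = y q) (agree_off S x y).
Proof.
apply: (iffP forallP) => [h q qS|h q]; last by apply/implyP => /h ->.
by apply/eqP; move: (h q); rewrite qS.
Qed.

Lemma agree_off_trans S x y z :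
  agree_off S x z -> agree_off S y z = agree_off S x y.
Proof.
move=> /agree_offP h.
by apply/agree_offP/agree_offP => k q qS; move: (h _ qS) (k _ qS) => -> ->.
Qed.

Lemma mx_unitary_sum n (U : 'M[R[i]]_n) i j :
  U \is unitarymx -> \sum_k U i k * (U j k)^* = (i == j)%:R.
Proof.
move=> /unitarymxP/matrixP/(_ i j); rewrite !mxE => <-.
by apply: eq_bigr => k _; rewrite !mxE.
Qed.

Lemma extend_unitary S (U : qop R {q | q \in S}) :
  U \is unitarymx -> extend U \is unitarymx.
Proof.
move=> uU.
pose upd x (w : {ffun {q | q \in S} -> 'I_2}) : {ffun Q -> 'I_2} :=
  [ffun q => if insub q is Some k then w k else x q].
apply: (@local_unitary R _ _ (restrict_bits S) upd (agree_off S)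
  (fun a b => U (enum_rank a) (enum_rank b))).
- by move=> x w; apply/ffunP => q; rewrite !ffunE valK.
- move=> x z; apply/agree_offP/eqP => [h|-> q qS].
    apply/ffunP => q; rewrite !ffunE; case: insubP => [k _ <-|/h ->//].
    by rewrite ffunE.
  by rewrite ffunE insubN.
- by move=> x; apply/agree_offP.
- by move=> x y z; exact: agree_off_trans.
- move=> a b; rewrite -(inj_eq enum_rank_inj) -(mx_unitary_sum _ _ uU).
  rewrite (reindex (@enum_rank {ffun {q | q \in S} -> 'I_2})) //.
  exact/onW_bij/enum_rank_bij.
- by move=> r s; rewrite mxE.
Qed.

Lemma on_qubit_unitary q (A : 'M[R[i]]_2) :
  A \is unitarymx -> on_qubit q A \is unitarymx.
Proof.
move=> uA.
pose upd x (w : 'I_2) : {ffun Q -> 'I_2} := [ffun k => if k == q then w else x k].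
apply: (@local_unitary R _ _ (fun x => x q) upd (agree_off [set q])
  (fun a b => A a b)).
- by move=> x w; rewrite ffunE eqxx.
- move=> x z; apply/agree_offP/eqP => [h|-> k].
    apply/ffunP => k; rewrite !ffunE; case: eqP => [->//|/eqP kq].
    by rewrite h // inE.
  by rewrite inE ffunE => /negbTE ->.
- by move=> x; apply/agree_offP.
- by move=> x y z; exact: agree_off_trans.
- by move=> a b; rewrite -(mx_unitary_sum _ _ uA).
- by move=> r s; rewrite mxE.
Qed.

Lemma cnot_bitsK c t : c != t -> involutive (cnot_bits c t).
Proof.
move=> ct x; apply/ffunP => q; rewrite !ffunE eqxx (negbTE ct).
case: eqP => [->|//]; rewrite -addrA.
by case: (x c) => -[|[|//]] p; apply/val_inj;
  case: (x t) => -[|[|//]] p'.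
Qed.

Lemma CNOT_unitary c t : c != t -> CNOT c t \is unitarymx.
Proof.
move=> ct; apply/unitarymxP/matrixP => r s; rewrite !mxE.
rewrite (bigD1 (enum_rank (cnot_bits c t (enum_val r)))) //= big1 => [|k].
  rewrite !mxE enum_rankK cnot_bitsK // eqxx mul1r addr0 rmorph_nat.
  by rewrite (inj_eq enum_val_inj) eq_sym.
rewrite !mxE -(inj_eq enum_val_inj) enum_rankK => kr.
case: eqP => [e|]; last by rewrite mul0r.
by rewrite e cnot_bitsK // eqxx in kr.
Qed.

Definition is_unit_vector (psi : qvec R Q) := \sum_r `|psi r 0| ^+ 2 == 1.

Definition unit_vector := {psi : qvec R Q | is_unit_vector psi}.

Definition same_ray (u v : unit_vector) : bool :=
  `[< exists z : R[i], `|z| = 1 /\ val v = z *: val u >].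

Lemma same_ray_refl : reflexive same_ray.
Proof. by move=> u; apply/asboolP; exists 1; rewrite normr1 scale1r. Qed.

Lemma same_ray_sym : symmetric same_ray.
Proof.
suff h u v : same_ray u v -> same_ray v u by move=> u v; apply/idP/idP; exact: h.
move=> /asboolP[z [z1 vE]]; apply/asboolP; exists z^-1.
have z0 : z != 0 by rewrite -normr_eq0 z1 oner_eq0.
by rewrite normfV z1 invr1 vE scalerA mulVf // scale1r.
Qed.

Lemma same_ray_trans : transitive same_ray.
Proof.
move=> v u w /asboolP[z [z1 vE]] /asboolP[t [t1 wE]]; apply/asboolP.
by exists (t * z); rewrite normrM z1 t1 mulr1 wE vE scalerA.
Qed.

Canonical same_ray_equiv :=
  EquivRel same_ray same_ray_refl same_ray_sym same_ray_trans.

Definition pure_state := {eq_quot same_ray}.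

Lemma is_unit_vectorE (psi : qvec R Q) :
  is_unit_vector psi = (psi ^t* *m psi == 1%:M).
Proof.
have e : (psi ^t* *m psi) 0 0 = \sum_r `|psi r 0| ^+ 2.
  by rewrite mxE; apply: eq_bigr => r _; rewrite !mxE normCK mulrC.
apply/eqP/eqP => [h|/matrixP/(_ 0 0)]; last by rewrite e mxE eqxx.
by apply/matrixP => i j; rewrite !ord1 e mxE eqxx.
Qed.

Lemma unitary_unit_vector (A : qop R Q) (psi : unit_vector) :
  A \is unitarymx -> is_unit_vector (A *m val psi).
Proof.
move=> uA; have := valP psi; rewrite !is_unit_vectorE => /eqP uv.
rewrite trmx_mul map_mxM mulmxA -(mulmxA _ _ A).
suff -> : A ^t* *m A = 1%:M by rewrite mulmx1; apply/eqP.
by rewrite -invmx_unitary // mulVmx // unitarymx_unit.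
Qed.

Definition apply_unitary (A : qop R Q) (uA : A \is unitarymx)
    (psi : unit_vector) : unit_vector :=
  exist _ (A *m val psi) (unitary_unit_vector psi uA).

(* |psi> |-> A |psi> on pure states; it is independent of the chosen
   representative by state_map_pi. *)
Definition state_map (A : qop R Q) (uA : A \is unitarymx)
    (x : pure_state) : pure_state :=
  \pi_pure_state (apply_unitary uA (repr x)).

Lemma state_map_pi (A : qop R Q) (uA : A \is unitarymx) (psi : unit_vector) :
  state_map uA (\pi_pure_state psi) = \pi_pure_state (apply_unitary uA psi).
Proof.
apply/eqmodP/asboolP.
have /eqmodP/asboolP[z [z1 e]] : repr (\pi_pure_state psi) = psi %[mod pure_state].
  by rewrite reprK.
by exists z; split => //=; rewrite e scalemxAr.
Qed.

Lemma prod_unitary I (s : seq I) (P : pred I) (F : I -> qop R Q) :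
  (forall i, P i -> F i \is unitarymx) -> \prod_(i <- s | P i) F i \is unitarymx.
Proof.
move=> h; apply: (big_ind (fun A : qop R Q => A \is unitarymx)) => //; last by move=> A B; exact: mul_unitarymx.
have : (1%:M : qop R Q) \is unitarymx by apply/unitarymxP; rewrite trmx1 map_mx1 mulmx1.
exact.
Qed.

End Registers.

Definition expmx (K : numFieldType) n (A : 'M[K]_n.+1) : 'M[K]_n.+1 :=
  limn (series (fun k => (k`!%:R)^-1 *: A ^+ k)).

Lemma expmx_lin_cvg (K : numFieldType) n (A U V : 'M[K]_n.+1) (u v : nat -> K) (a b : K) :
  (forall k, (k`!%:R)^-1 *: A ^+ k = u k *: U + v k *: V) ->
  series u @ \oo --> a -> series v @ \oo --> b -> expmx A = a *: U + b *: V.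
Proof.
move=> e ua vb; apply: cvg_lim; first exact: norm_hausdorff.
have -> : series (fun k => (k`!%:R)^-1 *: A ^+ k) =
    (fun n => series u n *: U + series v n *: V).
  apply/funext => m; rewrite /series /= !scaler_suml -big_split /=.
  by apply: eq_bigr => k _.
by apply: cvgD; apply: cvgZr_tmp.
Qed.

Section SingleQubitGates.
Variable R : realType.
Implicit Types theta : R.

Definition Hadamard : 'M[R[i]]_2 :=
  ((Num.sqrt 2)^-1)%:C *: \matrix_(a, b) (-1) ^+ (a * b).

Definition PauliX : 'M[R[i]]_2 := \matrix_(a, b) (a != b)%:R.

Definition Rx theta : 'M[R[i]]_2 := expmx ((- 'i%C * (theta / 2)%:C) *: PauliX).

(* L = H Rx(beta) H Rx(gamma) H Rx(delta) H, with (beta, gamma, delta) given by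
   p 0, p 1, p 2. *)
Definition level1 (p : 'I_3 -> R) : 'M[R[i]]_2 :=
  Hadamard *m Rx (p 0) *m Hadamard *m Rx (p 1) *m Hadamard *m Rx (p 2) *m Hadamard.

Lemma PauliX2 : PauliX ^+ 2 = 1.
Proof.
rewrite expr2; apply/matrixP => a b; rewrite !mxE !big_ord_recl big_ord0 !mxE.
by case: a => -[|[|//]] ?; case: b => -[|[|//]] ? /=;
  rewrite !(mul0r, mulr0, mul1r, addr0, add0r).
Qed.

Lemma gt0_complexP (e : R[i]) : 0 < e -> exists2 r : R, 0 < r & e = r%:C.
Proof.
by case: e => r s; rewrite ltcE /= => /andP[/eqP -> r0]; exists r.
Qed.

Lemma cvg_real_complex (u : R^nat) (l : R) :
  u @ \oo --> l ->
  (fun k => (u k)%:C : (R[i] : numFieldType)) @ \oo --> (l%:C : (R[i] : numFieldType)).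
Proof.
move=> ul; apply/cvgrPdist_lt => /= e /gt0_complexP[r r0 ->].
move/cvgrPdist_lt : ul => /(_ _ r0); apply: filterS => k h.
by rewrite -rmorphB normc_def /= expr0n addr0 sqrtr_sqr ltcR.
Qed.

Lemma expmx_term (t : R) k :
  (k`!%:R)^-1 *: ((- 'i%C * t%:C) *: PauliX) ^+ k =
  (cos_coeff t k)%:C *: 1 + (sin_coeff t k)%:C *: (- 'i%C *: PauliX).
Proof.
rewrite exprZn /cos_coeff /sin_coeff /= -[in LHS](odd_double_half k).
set m := k./2; rewrite exprMn.
have iX : (- 'i%C) ^+ m.*2 = (-1) ^+ m :> R[i].
  by rewrite -mul2n exprM sqrrN sqr_i.
have XX : PauliX ^+ m.*2 = 1 by rewrite -mul2n exprM PauliX2 expr1n.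
have kE : k = (odd k + m.*2)%N by rewrite odd_double_half.
case: (odd k) kE => /= kE.
  rewrite !add1n /= !mul0r !rmorph0 scale0r add0r.
  have -> : k.-1./2 = m by rewrite kE add1n /= doubleK.
  rewrite (exprS (- 'i%C) m.*2) iX (exprS PauliX m.*2) XX mulr1 !scalerA mul1r kE add1n.
  congr (_ *: _); rewrite !rmorphM /= fmorphV /= !rmorphXn /= rmorphN1 rmorph_nat.
  move: (_^-1) => f; move: (t%:C ^+ _) => x; move: ((-1) ^+ m) => y.
  by ring.
rewrite !add0n mul0r !mul0r !rmorph0 scale0r addr0 iX XX scalerA mul1r kE add0n.
congr (_ *: _); rewrite !rmorphM /= fmorphV /= -exprnP !rmorphXn /= rmorphN1 rmorph_nat.
by rewrite mulrC.
Qed.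

Lemma RxE theta :
  Rx theta = (cos (theta / 2))%:C *: 1 + (sin (theta / 2))%:C *: (- 'i%C *: PauliX).
Proof.
apply: expmx_lin_cvg.
- by move=> k; exact: expmx_term.
- have -> : series (fun k => (cos_coeff (theta / 2) k)%:C) =
      (fun n => (series (cos_coeff (theta / 2)) n)%:C).
    by apply/funext => n; rewrite /series /= rmorph_sum.
  by apply: cvg_real_complex; rewrite cos.unlock; exact: is_cvg_series_cos_coeff.
- have -> : series (fun k => (sin_coeff (theta / 2) k)%:C) =
      (fun n => (series (sin_coeff (theta / 2)) n)%:C).
    by apply/funext => n; rewrite /series /= rmorph_sum.
  by apply: cvg_real_complex; rewrite sin.unlock; exact: is_cvg_series_sin_coeff.
Qed.

Lemma Rx_unitary theta : Rx theta \is unitarymx.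
Proof.
rewrite RxE; apply/unitarymxP.
have := cos2Dsin2 (theta / 2).
move: (cos _) (sin _) => x y xy.
apply/matrixP => a b; rewrite !mxE !big_ord_recl big_ord0 !mxE.
case: a => -[|[|//]] ?; case: b => -[|[|//]] ? /=;
  apply/eqP; rewrite eq_complex /=; simpc.
all: by rewrite ?andbT /= -?xy; apply/eqP; ring.
Qed.

Lemma Hadamard_unitary : Hadamard \is unitarymx.
Proof.
apply/unitarymxP/matrixP => a b; rewrite !mxE !big_ord_recl big_ord0 !mxE.
case: a => -[|[|//]] ?; case: b => -[|[|//]] ? /=;
  apply/eqP; rewrite eq_complex /=; simpc => //=.
all: rewrite andbT -mulr2n -invfM -expr2 sqr_sqrtr //.
all: by rewrite -[X in X == 1]mulr_natr mulVf ?pnatr_eq0.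
Qed.

Lemma level1_unitary p : level1 p \is unitarymx.
Proof. by rewrite /level1 !(mul_unitarymx, Hadamard_unitary, Rx_unitary). Qed.

End SingleQubitGates.

Section Circuits.
Variables (R : realType) (n : nat).

Definition is_gate (b : nat) (G : qop R 'I_n) : Prop :=
  exists S : {set 'I_n}, (#|S| <= b)%N /\
  exists2 U : qop R {q | q \in S}, U \is unitarymx & G = extend U.

(* The number of gates is at most the real power n ^ c. *)
Definition is_circuit (b : nat) (c : R) (C : qop R 'I_n) : Prop :=
  exists gs : seq (qop R 'I_n),
    [/\ (size gs)%:R <= n%:R `^ c, forall G, G \in gs -> is_gate b G &
        C = \prod_(G <- gs) G].

Lemma circuit_unitary b c C : is_circuit b c C -> C \is unitarymx.
Proof.
move=> [gs [_ gP ->]]; rewrite big_seq; apply: prod_unitary => G /gP.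
by move=> [S [_ [U uU ->]]]; exact: extend_unitary.
Qed.

(* Qubits are numbered from 0: this is "qubit 1", and the level-2 blocks
   B_2, ..., B_n are those with i : 'I_n and 0 < i. *)
Definition first_qubit (i : 'I_n) : 'I_n :=
  Ordinal (leq_ltn_trans (leq0n i) (ltn_ord i)).

(* p k, for k = 0, 1, 2, 3, are the parameters of L^(k+1). *)
Definition level2 (i : 'I_n) (p : 'I_4 -> 'I_3 -> R) : qop R 'I_n :=
  let q1 := first_qubit i in
  CNOT R q1 i *m (on_qubit q1 (level1 (p 2)) *m on_qubit i (level1 (p 3))) *m
  CNOT R q1 i *m (on_qubit q1 (level1 (p 0)) *m on_qubit i (level1 (p 1))).

Definition layer (p : 'I_n -> 'I_4 -> 'I_3 -> R) : qop R 'I_n :=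
  \prod_(i <- rev (enum 'I_n) | (0 < i)%N) level2 i (p i).

Definition ansatz (d : nat) (theta : 'I_d -> 'I_n -> 'I_4 -> 'I_3 -> R) :
    qop R 'I_n :=
  \prod_(l < d) layer (theta l).

Lemma level2_unitary (i : 'I_n) p : (0 < i)%N -> level2 i p \is unitarymx.
Proof.
move=> i0; have neq : first_qubit i != i by rewrite -val_eqE /= eq_sym -lt0n.
by rewrite /level2 !(mul_unitarymx, CNOT_unitary, on_qubit_unitary, level1_unitary).
Qed.

Lemma ansatz_unitary d (theta : 'I_d -> 'I_n -> 'I_4 -> 'I_3 -> R) :
  ansatz theta \is unitarymx.
Proof.
apply: prod_unitary => l _; apply: prod_unitary => i i0.
exact: level2_unitary.
Qed.

Definition hypothesis_space (d : nat) :
    set (pure_state R 'I_n -> pure_state R 'I_n) :=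
  [set f | exists2 theta : 'I_d -> 'I_n -> 'I_4 -> 'I_3 -> R,
     forall l i k a, 0 <= theta l i k a < 2 * pi &
     f = state_map (ansatz_unitary theta)].

End Circuits.

(* Main.v *)
Require Import Defs.
From mathcomp Require Import all_boot all_order all_algebra.
From mathcomp Require Import all_classical all_reals all_analysis.
From mathcomp Require Import complex ring.

Set Implicit Arguments.
Unset Strict Implicit.
Unset Printing Implicit Defensive.

Import Order.TTheory GRing.Theory Num.Theory ComplexField.
Local Open Scope complex_scope.
Local Open Scope ring_scope.
Local Open Scope sesquilinear_scope.

(* It suffices to write every unitary on m qubits as a product of a number of
   CNOTs and single-qubit gates depending only on m: each of these, placed on
   any qubits of the register, is produced up to phase by at most 16 layers, the
   unused blocks being set to CNOT CNOT = 1.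

   Diagonal unitaries: u(x) = a(x) b(x)^((-1)^(x_q)) with a and b not depending
   on x_q; iterating over the qubits reduces u to factors z^((-1)^parity), each
   of which is a single-qubit gate conjugated by CNOTs.
   General unitaries: for each qubit q, a product H_q D2 H_q D1 with diagonal D1
   and D2 moves the amplitudes of a vector v to the strings with x_q = 0, so some
   product W sends v to a multiple of |0>.  Then 1 + (d - 1) v v^* is
   W^* D W with D diagonal, and by the spectral theorem a unitary is the product of
   such operators over an orthonormal eigenbasis.

   A level-1 block is an Euler product Rz Rx Rz, because H Rx H = Rz; angles in
   [0, 2 pi) reach all of SU(2) up to sign. *)

(** * Operators read on bit strings: controlled, diagonal and CNOT gates *)

Section Operators.
Context (R : realType) (Q : finType).
Local Notation W := {ffun Q -> 'I_2}.
Implicit Types (x y z : W) (q c t : Q).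

Definition entry (A : qop R Q) x y : R[i] := A (enum_rank x) (enum_rank y).

Lemma qopP (A B : qop R Q) : (forall x y, entry A x y = entry B x y) -> A = B.
Proof.
by move=> AB; apply/matrixP => r s; have := AB (enum_val r) (enum_val s); rewrite /entry !enum_valK.
Qed.

Lemma sum_strings (f : 'I_#|{: W}| -> R[i]) : \sum_r f r = \sum_x f (enum_rank x).
Proof. exact/reindex/onW_bij/enum_rank_bij. Qed.

Lemma entry_mul (A B : qop R Q) x y : entry (A *m B) x y = \sum_z entry A x z * entry B z y.
Proof. by rewrite /entry mxE sum_strings. Qed.

Lemma entry1 x y : entry 1%:M x y = (x == y)%:R.
Proof. by rewrite /entry mxE (inj_eq enum_rank_inj). Qed.

Lemma entryZ a A x y : entry (a *: A) x y = a * entry A x y.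
Proof. by rewrite /entry mxE. Qed.

Lemma entry_adj A x y : entry (A ^t*) x y = (entry A y x)^*.
Proof. by rewrite /entry !mxE. Qed.

Definition upd x q (a : 'I_2) : W := [ffun k => if k == q then a else x k].

Lemma updK x q a : upd x q a q = a.
Proof. by rewrite ffunE eqxx. Qed.

Lemma upd_id x q : upd x q (x q) = x.
Proof. by apply/ffunP => k; rewrite ffunE; case: eqP => [->|]. Qed.

Lemma upd_neq x q a k : k != q -> upd x q a k = x k.
Proof. by rewrite ffunE => /negbTE ->. Qed.

Lemma upd_upd x q a a' : upd (upd x q a) q a' = upd x q a'.
Proof. by apply/ffunP => k; rewrite !ffunE; case: eqP. Qed.

Lemma agree_off1E q x z : agree_off [set q] x z = (z == upd x q (z q)).
Proof.
apply/agree_offP/eqP => [h|-> k]; last by rewrite inE => kq; rewrite upd_neq.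
apply/ffunP => k; rewrite ffunE; case: eqP => [->//|/eqP kq].
by rewrite h // inE.
Qed.

Lemma agree_off_refl (S : {set Q}) x : agree_off S x x.
Proof. exact/agree_offP. Qed.

Lemma agree_off_sym (S : {set Q}) x y : agree_off S x y = agree_off S y x.
Proof. by apply/agree_offP/agree_offP => h q /h. Qed.

Lemma sum_agree_off1 q x (f : W -> R[i]) :
  \sum_(z | agree_off [set q] x z) f z = \sum_(a < 2) f (upd x q a).
Proof.
rewrite (reindex_onto (upd x q) (fun z => z q)) /=; last first.
  by move=> z; rewrite agree_off1E => /eqP <-.
by apply: eq_bigl => a; rewrite agree_off1E updK !eqxx.
Qed.

(* The uniformly controlled gate applying A x to qubit q; it is only meaningful
   when A x does not depend on x q. *)
Definition mux q (A : W -> 'M[R[i]]_2) : qop R Q :=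
  \matrix_(r, s)
    let x := enum_val r in let y := enum_val s in
    if agree_off [set q] x y then A x (x q) (y q) else 0.

Lemma entry_mux q A x y :
  entry (mux q A) x y = if agree_off [set q] x y then A x (x q) (y q) else 0.
Proof. by rewrite /entry mxE !enum_rankK. Qed.

Lemma on_qubitE q V : on_qubit q V = mux q (fun=> V).
Proof. by []. Qed.

(** The second factor is evaluated at an intermediate string that differs from [x] at most at [q];
    the invariance of [B] under [upd] brings it back to [x]. *)
Lemma mux_mul q (A B : W -> 'M[R[i]]_2) :
  (forall x a, B (upd x q a) = B x) ->
  mux q A *m mux q B = mux q (fun x => A x *m B x).
Proof.
move=> hB; apply: qopP => x y; rewrite entry_mul entry_mux.
transitivity (\sum_(z | agree_off [set q] x z)
   A x (x q) (z q) * (if agree_off [set q] x y then B z (z q) (y q) else 0)).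
  rewrite [RHS]big_mkcond; apply: eq_bigr => z _; rewrite !entry_mux.
  have [xz|] := boolP (agree_off [set q] x z); last by rewrite mul0r.
  by rewrite (agree_off_sym _ z y) (agree_off_trans y xz).
rewrite sum_agree_off1; case: ifP => _; last by rewrite big1 // => a _; rewrite mulr0.
by rewrite mxE; apply: eq_bigr => a _; rewrite updK hB.
Qed.

Lemma mux1 q : mux q (fun=> 1%:M) = 1%:M.
Proof.
apply: qopP => x y; rewrite entry_mux entry1 mxE agree_off1E.
have [->|nxy] := eqVneq x y; first by rewrite upd_id !eqxx.
case: (eqVneq y) => // yE.
suff /negbTE -> : x q != y q by [].
by apply: contra nxy => /eqP xyq; rewrite yE -xyq upd_id.
Qed.

Lemma on_qubit1 q : on_qubit q 1%:M = 1%:M :> qop R Q.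
Proof. exact: mux1. Qed.

Lemma on_qubitZ q a V : on_qubit q (a *: V) = a *: on_qubit q V :> qop R Q.
Proof.
apply: qopP => x y; rewrite entryZ !on_qubitE !entry_mux mxE.
by case: ifP; rewrite ?mulr0.
Qed.

Lemma on_qubit_adj q V : (on_qubit q V) ^t* = on_qubit q (V ^t*) :> qop R Q.
Proof.
apply: qopP => x y; rewrite entry_adj !on_qubitE !entry_mux !mxE agree_off_sym.
by case: ifP => // _; rewrite rmorph0.
Qed.

Definition dgate (u : W -> R[i]) : qop R Q := diag_mx (\row_r u (enum_val r)).

Lemma entry_dgate u x y : entry (dgate u) x y = (u x) *+ (x == y).
Proof. by rewrite /entry !mxE enum_rankK (inj_eq enum_rank_inj). Qed.

(** Fixing all bits but that of [q] leaves a 2 x 2 diagonal matrix; when it is the same for every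
    string, the operator is a gate on [q] alone. *)
Lemma dgate_mux q u :
  dgate u = mux q (fun x => diag_mx (\row_a u (upd x q a))).
Proof.
apply: qopP => x y; rewrite entry_dgate entry_mux !mxE upd_id agree_off1E.
have [->|nxy] := eqVneq x y; first by rewrite upd_id !eqxx.
case: (eqVneq y) => // yE.
suff /negbTE -> : x q != y q by [].
by apply: contra nxy => /eqP xyq; rewrite yE -xyq upd_id.
Qed.

Lemma dgate_mul u v : dgate u *m dgate v = dgate (fun x => u x * v x).
Proof. by rewrite /dgate mulmx_diag; congr diag_mx; apply/rowP => i; rewrite !mxE. Qed.

Lemma eq_dgate u v : u =1 v -> dgate u = dgate v.
Proof. by move=> uv; congr diag_mx; apply/rowP => i; rewrite !mxE uv. Qed.

Lemma dgate_const a : dgate (fun=> a) = a%:M.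
Proof. by rewrite -diag_const_mx; congr diag_mx; apply/rowP => i; rewrite !mxE. Qed.

Lemma entry_CNOT c t x y : entry (CNOT R c t) x y = (x == cnot_bits c t y)%:R.
Proof. by rewrite /entry mxE !enum_rankK. Qed.

Lemma entry_CNOT_mul c t (A : qop R Q) x y : c != t ->
  entry (CNOT R c t *m A) x y = entry A (cnot_bits c t x) y.
Proof.
move=> ct; rewrite entry_mul (bigD1 (cnot_bits c t x)) //= entry_CNOT cnot_bitsK //.
rewrite eqxx mul1r big1 ?addr0 // => z zx; rewrite entry_CNOT.
case: eqP => [xE|]; last by rewrite mul0r.
by rewrite xE cnot_bitsK // eqxx in zx.
Qed.

Lemma CNOTK c t : c != t -> CNOT R c t *m CNOT R c t = 1%:M.
Proof.
move=> ct; apply: qopP => x y; rewrite entry_CNOT_mul // entry_CNOT entry1.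
by rewrite (inj_eq (inv_inj (cnot_bitsK ct))).
Qed.

Lemma CNOT_adj c t : c != t -> (CNOT R c t) ^t* = CNOT R c t.
Proof.
move=> ct; apply: qopP => x y; rewrite entry_adj !entry_CNOT rmorph_nat.
by rewrite eq_sym (canF_eq (cnot_bitsK ct)).
Qed.

(** A CNOT is an involutive permutation of the basis strings, so conjugation only relabels the
    diagonal. *)
Lemma CNOT_dgate c t u : c != t ->
  CNOT R c t *m dgate u *m CNOT R c t = dgate (u \o cnot_bits c t).
Proof.
move=> ct; apply: qopP => x y; rewrite -mulmxA entry_CNOT_mul // entry_mul.
rewrite (bigD1 (cnot_bits c t x)) //= big1 => [|z zx].
  rewrite !entry_dgate eqxx entry_CNOT (inj_eq (inv_inj (cnot_bitsK ct))) addr0.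
  by rewrite mulr_natr.
by rewrite entry_dgate eq_sym (negbTE zx) mul0r.
Qed.

End Operators.

(** * Two-by-two matrices and unimodular numbers *)

Lemma mulmx2E (K : pzSemiRingType) (A B : 'M[K]_2) i j :
  (A *m B) i j = A i 0 * B 0 j + A i 1 * B 1 j.
Proof.
rewrite mxE !big_ord_recl big_ord0 addr0.
by congr (_ + A i _ * B _ j); apply/val_inj.
Qed.

Lemma mx2P (K : Type) (A B : 'M[K]_2) :
  A 0 0 = B 0 0 -> A 0 1 = B 0 1 -> A 1 0 = B 1 0 -> A 1 1 = B 1 1 -> A = B.
Proof.
move=> h00 h01 h10 h11; apply/matrixP => i j.
have I2 (k : 'I_2) : k = 0 \/ k = 1.
  by case: k => -[|[|//]] p; [left|right]; apply/val_inj.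
by case: (I2 i) => ->; case: (I2 j) => ->.
Qed.

Lemma ord2P (a : 'I_2) : a = 0 \/ a = 1.
Proof. by case: a => -[|[|//]] p; [left|right]; apply/val_inj. Qed.

Section Unimodular.
Context (K : numClosedFieldType).
Implicit Types (z w : K).

(* z ^ ((-1) ^ a) for unimodular z. *)
Definition twist (a : 'I_2) z := if a == 0 then z else z^*.

Lemma twist0 z : twist 0 z = z.
Proof. by []. Qed.

Lemma twist1 z : twist 1 z = z^*.
Proof. by []. Qed.

Lemma twistD a a' z : twist (a + a') z = twist a (twist a' z).
Proof.
case: (ord2P a) => ->; case: (ord2P a') => -> //.
by rewrite /twist /= conjCK.
Qed.

Lemma twistM a z w : twist a (z * w) = twist a z * twist a w.
Proof. by rewrite /twist; case: ifP; rewrite ?rmorphM. Qed.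

Lemma norm_twist a z : `|twist a z| = `|z|.
Proof. by rewrite /twist; case: ifP; rewrite ?norm_conjC. Qed.

Lemma norm1_conj z : `|z| = 1 -> z^* * z = 1.
Proof. by move=> z1; rewrite mulrC -normCK z1 expr1n. Qed.

Lemma norm1_neq0 z : `|z| = 1 -> z != 0.
Proof. by move=> z1; rewrite -normr_eq0 z1 oner_eq0. Qed.

Lemma norm1_conj_inv z : `|z| = 1 -> z^* = z^-1.
Proof.
move=> z1; apply: (mulIf (norm1_neq0 z1)).
by rewrite norm1_conj // mulVf // norm1_neq0.
Qed.

Lemma norm1_sqrtC z : `|z| = 1 -> `|sqrtC z| = 1.
Proof.
by move=> z1; apply/eqP; rewrite -(@pexpr_eq1 _ _ 2) // -normrX sqrtCK z1.
Qed.

(** Take [p.1] a square root of z w and [p.2] = z / [p.1]. Then [p.1] / [p.2] = w, and conjugation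
    inverts unimodular numbers. *)
Lemma unimodular_split z w : `|z| = 1 -> `|w| = 1 ->
  exists p : K * K, [/\ `|p.1| = 1, `|p.2| = 1, z = p.1 * p.2 & w = p.1 * p.2^*].
Proof.
move=> z1 w1; set a := sqrtC (z * w).
have a1 : `|a| = 1 by rewrite norm1_sqrtC // normrM z1 w1 mulr1.
have a0 := norm1_neq0 a1.
have b1 : `|z / a| = 1 by rewrite normrM normfV z1 a1 divr1.
exists (a, z / a); split => //=; first by rewrite mulrC divfK.
apply: (mulIf (norm1_neq0 b1)); rewrite -mulrA norm1_conj // mulr1.
apply: (mulIf a0); rewrite -mulrA divfK // -expr2 sqrtCK; ring.
Qed.

End Unimodular.

(** * Products of counted elementary gates; parity phases *)

Section Synthesis.
Context (R : realType) (Q : finType).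
Local Notation W := {ffun Q -> 'I_2}.
Implicit Types (x y : W) (q c t : Q) (s : seq Q) (u : W -> R[i]).

(* Global phases are free, and the count is only an upper bound. *)
Inductive synth : nat -> qop R Q -> Prop :=
| synth_phase k z : `|z| = 1 -> synth k z%:M
| synth_qubit q V : V \is unitarymx -> synth 1 (on_qubit q V)
| synth_CNOT c t : c != t -> synth 1 (CNOT R c t)
| synth_mul k l A B : synth k A -> synth l B -> synth (k + l) (A *m B).

Lemma scalar_unitary n (z : R[i]) : `|z| = 1 -> (@scalar_mx _ n z) \is unitarymx.
Proof.
move=> z1; apply/unitarymxP.
by rewrite tr_scalar_mx map_scalar_mx -scalar_mxM mulrC norm1_conj.
Qed.

Lemma synth_unitary k A : synth k A -> A \is unitarymx.
Proof.
elim=> [{}k z /scalar_unitary //|q V|c t|{}k l {}A B _ uA _ uB].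
- exact: on_qubit_unitary.
- exact: CNOT_unitary.
- exact: (mul_unitarymx uA uB).
Qed.

Lemma synth_adj k A : synth k A -> synth k (A ^t*).
Proof.
elim=> [{}k z z1|q V uV|c t ct|{}k l {}A B _ sA _ sB].
- by rewrite tr_scalar_mx map_scalar_mx; apply: synth_phase; rewrite norm_conjC.
- by rewrite on_qubit_adj; apply: synth_qubit; rewrite trmxC_unitary.
- by rewrite CNOT_adj //; apply: synth_CNOT.
- by rewrite trmx_mul map_mxM addnC; apply: synth_mul.
Qed.

Lemma synth_leq k l A : (k <= l)%N -> synth k A -> synth l A.
Proof.
move=> kl sA; rewrite -(subnKC kl) -[A]mulmx1; apply: synth_mul => //.
by apply: synth_phase; rewrite normr1.
Qed.

Definition parity s x : 'I_2 := \sum_(q <- s) x q.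

Lemma parity_nil x : parity [::] x = 0.
Proof. exact: big_nil. Qed.

Lemma parity_cons q s x : parity (q :: s) x = x q + parity s x.
Proof. exact: big_cons. Qed.

Lemma parity_CNOT c t s x : t \notin s -> parity s (cnot_bits c t x) = parity s x.
Proof.
move=> ts; apply: eq_big_seq => q qs; rewrite ffunE.
by case: eqP => // qt; rewrite -qt qs in ts.
Qed.

Lemma diag_unitary n (d : 'rV[R[i]]_n) :
  (forall i, `|d 0 i| = 1) -> diag_mx d \is unitarymx.
Proof.
move=> d1; apply/unitarymxP; rewrite tr_diag_mx map_diag_mx mulmx_diag.
rewrite -diag_const_mx; congr diag_mx; apply/rowP => i; rewrite !mxE.
by rewrite mulrC norm1_conj.
Qed.

(** Induction on [s]: a CNOT from [q] to the head [t] of the rest adds bit [q] to bit [t], so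
    conjugation absorbs [q] into the parity for two more gates. *)
Lemma synth_parity s z : uniq s -> `|z| = 1 ->
  synth (2 * size s).+1 (dgate (fun x => twist (parity s x) z)).
Proof.
move=> us z1; elim: s us => [|q [|t s] IHs] us.
- rewrite (@eq_dgate _ _ _ (fun=> z)) => [|x]; last by rewrite parity_nil.
  by rewrite dgate_const; apply: synth_phase.
- apply: (@synth_leq 1) => //; rewrite (dgate_mux q).
  rewrite (_ : (fun _ => _) = fun=> diag_mx (\row_a twist a z)); last first.
    apply/funext => x; congr diag_mx; apply/rowP => a.
    by rewrite !mxE parity_cons parity_nil addr0 updK.
  by apply: synth_qubit; apply: diag_unitary => a; rewrite mxE norm_twist.
have qt : q != t by move: us; rewrite /= inE negb_or => /andP[/andP[]].
have -> : (2 * size [:: q, t & s]).+1 = (1 + (2 * size (t :: s)).+1 + 1)%N.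
  by rewrite /= !mulnS !addSn addn1 add0n.
have -> : dgate (fun x => twist (parity [:: q, t & s] x) z) =
    CNOT R q t *m dgate (fun x => twist (parity (t :: s) x) z) *m CNOT R q t.
  rewrite CNOT_dgate //; apply: eq_dgate => x /=; congr twist.
  have ts : t \notin s by move: us => /= /and3P[].
  by rewrite !parity_cons parity_CNOT // ffunE eqxx addrCA addrA.
apply: synth_mul; last exact: synth_CNOT.
apply: synth_mul; first exact: synth_CNOT.
by apply: IHs; case/andP: us.
Qed.

End Synthesis.

(* Cost of u ^ ((-1) ^ parity) when u depends on m bits and the parity is taken
   over a further bits: splitting off one bit of u gives two factors, one of them
   with that bit added to the parity. *)
Fixpoint dgate_cost m a :=
  if m is m'.+1 then (dgate_cost m' a + dgate_cost m' a.+1)%N else (2 * a).+1.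

(** * Diagonal unitaries *)

Section Diagonal.
Context (R : realType) (Q : finType).
Local Notation W := {ffun Q -> 'I_2}.
Implicit Types (x y : W) (q c t : Q) (s : seq Q) (u : W -> R[i]).

(** [s] lists the bits that [u] may depend on, [r] those already in the parity. Splitting the two
    values of [u] at the first bit [q] of [s] yields two factors free of [q], the second twisted by
    [q], which joins [r]. *)
Lemma synth_twist s r u : uniq (s ++ r) -> (forall x, `|u x| = 1) ->
  (forall x y, {in s, x =1 y} -> u x = u y) ->
  synth (dgate_cost (size s) (size r)) (dgate (fun x => twist (parity r x) (u x))).
Proof.
elim: s r u => [|q s IHs] r u /= usr u1 us.
  pose z := u [ffun=> 0]; rewrite (@eq_dgate _ _ _ (fun x => twist (parity r x) z)).
    exact: synth_parity usr (u1 _).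
  by move=> x; congr twist; apply: us.
(* The splitting is a function of the pair of values, so that [g] depends on the bits in [s] only;
   pairs that are not unimodular get a dummy value. *)
have /choice[f fP] : forall p : R[i] * R[i], exists v : R[i] * R[i],
    `|p.1| = 1 -> `|p.2| = 1 ->
    [/\ `|v.1| = 1, `|v.2| = 1, p.1 = v.1 * v.2 & p.2 = v.1 * v.2^*].
  move=> -[z w] /=.
  have [[z1 w1]|nzw] := pselect (`|z| = 1 /\ `|w| = 1); last first.
    by exists (0, 0) => z1 w1; case: nzw.
  by have [p pP] := unimodular_split z1 w1; exists p.
have [g gP gs] : exists2 g : W -> R[i] * R[i], (forall x,
    [/\ `|(g x).1| = 1, `|(g x).2| = 1 & u x = (g x).1 * twist (x q) (g x).2]) &
    forall x y, {in s, x =1 y} -> g x = g y.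
  exists (fun x => f (u (upd x q 0), u (upd x q 1))) => [x|x y xy].
    have [] := fP (u (upd x q 0), u (upd x q 1)) (u1 _) (u1 _).
    move: (f _) => p p1 p2 /= u0E u1E; split => //.
    rewrite -[in LHS](upd_id x q).
    by case: (ord2P (x q)) => ->; [rewrite twist0 u0E | rewrite twist1 u1E].
  by congr (f (_, _)); apply: us => k; rewrite inE !ffunE; case: eqP => //= _ /xy.
have -> : dgate (fun x => twist (parity r x) (u x)) =
    dgate (fun x => twist (parity r x) (g x).1) *m
    dgate (fun x => twist (parity (q :: r) x) (g x).2).
  rewrite dgate_mul; apply: eq_dgate => x; rewrite parity_cons addrC twistD -twistM.
  by congr twist; case: (gP x).
apply: synth_mul.
  apply: IHs; first by case/andP: usr.
    by move=> x; case: (gP x).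
  by move=> x y /gs ->.
apply: (IHs (q :: r)); first by rewrite (perm_uniq (permEl (perm_catCA s [:: q] r))).
  by move=> x; case: (gP x).
by move=> x y /gs ->.
Qed.

Lemma synth_dgate u : (forall x, `|u x| = 1) ->
  synth (dgate_cost #|Q| 0) (dgate u).
Proof.
move=> u1; rewrite cardE (@eq_dgate _ _ _ (fun x => twist (parity [::] x) (u x))).
  apply: (@synth_twist (enum Q) [::]) => //; first by rewrite cats0 enum_uniq.
  by move=> x y xy; congr u; apply/ffunP => q; apply: xy; rewrite mem_enum.
by move=> x; rewrite parity_nil.
Qed.

End Diagonal.

(** * State preparation, reflections and general unitaries *)

Lemma unitary_adjK (K : numClosedFieldType) n (U : 'M[K]_n) :
  U \is unitarymx -> U ^t* *m U = 1%:M.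
Proof. by move=> uU; rewrite -invmx_unitary // mulVmx // unitarymx_unit. Qed.

(* The last equation says that H diag(p.2) H diag(p.1) kills the second
   coordinate of (a0, a1). *)
Lemma polar_rotation (K : numClosedFieldType) (a0 a1 : K) :
  exists p : (K * K) * (K * K),
  [/\ `|p.1.1| = 1, `|p.1.2| = 1, `|p.2.1| = 1, `|p.2.2| = 1 &
      (p.2.1 - p.2.2) * (p.1.1 * a0) + (p.2.1 + p.2.2) * (p.1.2 * a1) = 0].
Proof.
have dephase (a : K) : exists2 d, `|d| = 1 & d * a = `|a|.
  have [->|a0'] := eqVneq a 0; first by exists 1; rewrite ?normr1 ?normr0 ?mulr0.
  exists (`|a| / a); last by rewrite divfK.
  by rewrite normrM normfV normr_id divff // normr_eq0.
have [d0 d01 d0E] := dephase a0; have [d1 d11 d1E] := dephase a1.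
set r := sqrtC (`|a0| ^+ 2 + `|a1| ^+ 2).
(* If both amplitudes vanish, any phases do. *)
have [r0|rN0] := eqVneq r 0.
  have /eqP : `|a0| ^+ 2 + `|a1| ^+ 2 == 0.
    by rewrite -[_ + _]sqrtCK -/r r0 expr0n.
  move/eqP; rewrite paddr_eq0 ?exprn_ge0 // !expf_eq0 /= !normr_eq0.
  move=> /andP[/eqP -> /eqP ->]; exists ((1, 1), (1, 1)).
  by rewrite /= !normr1 !mulr0 addr0.
have r_ge0 : 0 <= r by rewrite sqrtC_ge0 addr_ge0 ?exprn_ge0.
pose x := `|a0| / r; pose y := `|a1| / r.
have xR : x \is Num.real by rewrite ger0_real // divr_ge0.
have yR : y \is Num.real by rewrite ger0_real // divr_ge0.
have xy1 : x ^+ 2 + y ^+ 2 = 1.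
  by rewrite !expr_div_n -mulrDl sqrtCK divff // -[_ + _]sqrtCK -/r expf_neq0.
have norm1 (e : K) : e \is Num.real -> e ^+ 2 = y ^+ 2 -> `|x + 'i * e| = 1.
  move=> eR e2; apply/eqP; rewrite -(@pexpr_eq1 _ _ 2) //.
  by rewrite normC2_rect // e2 xy1.
(* With these phases the equation reads 2i (y |a0| - x |a1|) = 0, and x, y are |a0|, |a1| divided by
   the same r. *)
exists ((d0, - 'i * d1), (x + 'i * y, x - 'i * y)); rewrite /=; split => //.
- by rewrite normrM normrN normCi mul1r.
- exact: norm1.
- by rewrite -mulrN norm1 ?rpredN ?sqrrN.
rewrite -mulrA d0E d1E /x /y; have := sqrCi K; move: ('i) => I II.
ring.
Qed.

(** A rotation is H D2 H D1; a preparation takes one rotation per qubit; a reflection is a diagonal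
    operator conjugated by a preparation; a unitary takes one reflection for each of its 2^m
    eigenvectors. *)
Definition rotation_cost m := (1 + dgate_cost m 0 + (1 + dgate_cost m 0))%N.
Definition prep_cost m := (m * rotation_cost m)%N.
Definition reflection_cost m := (prep_cost m + dgate_cost m 0 + prep_cost m)%N.
Definition unitary_cost m := (2 ^ m * reflection_cost m)%N.

Section StatePreparation.
Context (R : realType) (Q : finType).
Local Notation W := {ffun Q -> 'I_2}.
Implicit Types (x y : W) (q c t : Q) (s : seq Q) (u : W -> R[i]).

Definition amp (v : qvec R Q) x : R[i] := v (enum_rank x) 0.

Lemma qvecP (v w : qvec R Q) : (forall x, amp v x = amp w x) -> v = w.
Proof.
move=> vw; apply/matrixP => r j; rewrite ord1.
by have := vw (enum_val r); rewrite /amp enum_valK.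
Qed.

Lemma amp_mul (A : qop R Q) v x : amp (A *m v) x = \sum_y entry A x y * amp v y.
Proof. by rewrite /amp mxE sum_strings. Qed.

Lemma amp_on_qubit q V v x :
  amp (on_qubit q V *m v) x =
  V (x q) 0 * amp v (upd x q 0) + V (x q) 1 * amp v (upd x q 1).
Proof.
rewrite amp_mul (eq_bigr (fun y => if agree_off [set q] x y
    then V (x q) (y q) * amp v y else 0)) => [|y _].
  rewrite -big_mkcond sum_agree_off1 !big_ord_recl big_ord0 addr0 !updK.
  by congr (_ + V _ _ * amp v (upd _ _ _)); apply/val_inj.
by rewrite on_qubitE entry_mux; case: ifP; rewrite ?mul0r.
Qed.

Lemma amp_dgate u v x : amp (dgate u *m v) x = u x * amp v x.
Proof. by rewrite /amp mul_diag_mx !mxE enum_rankK. Qed.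

(** The operator is H D2 H D1, with the phases of [polar_rotation] chosen for each setting of the
    other bits. It mixes only strings that differ at [q], so qubits cleared earlier stay cleared. *)
Lemma clear_qubit q v : exists A, [/\ synth (rotation_cost #|Q|) A,
  forall x, x q = 1 -> amp (A *m v) x = 0 &
  forall t, t != q -> (forall x, x t = 1 -> amp v x = 0) ->
    forall x, x t = 1 -> amp (A *m v) x = 0].
Proof.
have /choice[f fP] := fun p : R[i] * R[i] => polar_rotation p.1 p.2.
pose g x := f (amp v (upd x q 0), amp v (upd x q 1)).
have gP x := fP (amp v (upd x q 0), amp v (upd x q 1)).
(* The two strings that differ only at [q] share their four phases. *)
have gU x a : g (upd x q a) = g x by rewrite /g !upd_upd.
pose D1 := dgate (fun x => if x q == 0 then (g x).1.1 else (g x).1.2).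
pose D2 := dgate (fun x => if x q == 0 then (g x).2.1 else (g x).2.2).
pose H := on_qubit q (Hadamard R) : qop R Q.
exists (H *m D2 *m (H *m D1)); split.
- have sH : synth 1 H by apply/synth_qubit/Hadamard_unitary.
  by apply: synth_mul; apply: synth_mul => //; apply: synth_dgate => x;
    case: ifP => _; case: (gP x).
- move=> x xq; rewrite -!mulmxA amp_on_qubit !amp_dgate !amp_on_qubit !amp_dgate.
  rewrite xq !upd_upd !updK /= !gU.
  have [_ _ _ _] := gP x; rewrite -/(g x) /=; move: (g x) => [[d0 d1] [w0 w1]] /=.
  move: (amp _ _) (amp _ _) => a1 a0; rewrite !mxE /=; move: (_%:C) => h.
  change (1 %% 2)%N with 1%N; rewrite !muln0 !muln1 expr0 expr1.
  (* Each Hadamard contributes a scalar [h]; what remains is the equation of [polar_rotation]. *)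
  move=> e; transitivity (h * h * ((w0 - w1) * (d0 * a0) + (w0 + w1) * (d1 * a1))).
    by ring.
  by rewrite e mulr0.
- move=> t tq vt x xt; rewrite -!mulmxA amp_on_qubit !amp_dgate !amp_on_qubit !amp_dgate.
  have v0 a : amp v (upd x q a) = 0 by apply: vt; rewrite upd_neq.
  by rewrite !upd_upd !v0 !mulr0 !addr0 !mulr0 addr0.
Qed.

Lemma clear_qubits s v : exists2 A, synth (size s * rotation_cost #|Q|) A &
  forall x q, q \in s -> x q = 1 -> amp (A *m v) x = 0.
Proof.
elim: s => [|q s [A sA Av]].
  by exists 1%:M => //; apply: synth_phase; rewrite normr1.
have [B [sB Bq Bt]] := clear_qubit q (A *m v).
exists (B *m A); first by rewrite mulSn; apply: synth_mul.
move=> x t; rewrite inE -mulmxA => /orP[/eqP ->|ts xt]; first exact: Bq.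
have [tq|tq] := eqVneq t q; first by apply: Bq; rewrite -tq.
by apply: (Bt t) => // y; apply: Av.
Qed.

Definition ket0 : qvec R Q := delta_mx (enum_rank [ffun=> 0]) 0.

(** Once every qubit is cleared, only the amplitude of the zero string survives; it has modulus 1
    because the norm is preserved. *)
Lemma rotate_to_ket0 (v : qvec R Q) : v ^t* *m v = 1%:M ->
  exists A z, [/\ synth (prep_cost #|Q|) A, `|z| = 1 & A *m v = z *: ket0].
Proof.
move=> v1; have [A sA Av] := clear_qubits (enum Q) v.
pose z := amp (A *m v) [ffun=> 0].
have AvE : A *m v = z *: ket0.
  apply: qvecP => x; rewrite [RHS]mxE [ket0 _ _]mxE eqxx andbT (inj_eq enum_rank_inj).
  have [->|] := eqVneq x [ffun=> 0]; first by rewrite mulr1.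
  rewrite mulr0 => x0; have [q xq] : exists q, x q != 0.
    apply/existsP; apply: contraR x0 => /existsPn x0; apply/eqP/ffunP => q.
    by rewrite ffunE; apply/eqP; rewrite -[_ == _]negbK; exact: x0.
  by apply: (Av x q); rewrite ?mem_enum //; case: (ord2P (x q)) xq => ->.
exists A, z; split => //; first by rewrite -cardE in sA.
have : (A *m v) ^t* *m (A *m v) = 1%:M.
  rewrite trmx_mul map_mxM mulmxA -(mulmxA _ _ A).
  by rewrite (unitary_adjK (synth_unitary sA)) mulmx1.
move/matrixP/(_ 0 0); rewrite AvE !mxE (bigD1 (enum_rank [ffun=> 0])) //= big1.
  rewrite !mxE !eqxx !mulr1 addr0 mulr1n => e.
  by apply/eqP; rewrite -(@pexpr_eq1 _ _ 2) // normCK mulrC e.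
by move=> r r0; rewrite !mxE (negbTE r0) !mulr0.
Qed.

(** Conjugation by the [A] that sends [v] to a multiple of [ket0] reduces to a diagonal operator
    with [d] at the zero string and 1 elsewhere; the phase [z] cancels in the projector. *)
Lemma synth_reflection (v : qvec R Q) d : v ^t* *m v = 1%:M -> `|d| = 1 ->
  synth (reflection_cost #|Q|) (1%:M + (d - 1) *: (v *m v ^t*)).
Proof.
move=> v1 d1; have [A [z [sA z1 Av]]] := rotate_to_ket0 v1.
have AA := unitary_adjK (synth_unitary sA).
have vE : v = z *: (A ^t* *m ket0).
  by rewrite -[LHS]mul1mx -AA -mulmxA Av scalemxAr.
have -> : 1%:M + (d - 1) *: (v *m v ^t*) =
    A ^t* *m dgate (fun x => if x == [ffun=> 0] then d else 1) *m A.
  have -> : dgate (fun x : W => if x == [ffun=> 0] then d else 1) =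
      1%:M + (d - 1) *: (ket0 *m ket0 ^t*).
    apply: qopP => x y; rewrite entry_dgate /entry !mxE big_ord1 !mxE eqxx !andbT.
    rewrite !(inj_eq enum_rank_inj) rmorph_nat.
    have [->|nxy] := eqVneq x y.
      by case: eqP => _; rewrite !(mulr0, mulr1, mulr1n, addr0) // addrC subrK.
    rewrite !mulr0n add0r; have [x0|] := eqVneq x; last by rewrite mul0r mulr0.
    by rewrite -x0 eq_sym (negbTE nxy) !mulr0.
  rewrite mulmxDr mulmxDl mulmx1 AA -scalemxAr -scalemxAl; congr (_ + _ *: _).
  rewrite vE !linearZ /= map_mxZ -scalemxAl scalemxAr scalerA mulrC norm1_conj //.
  by rewrite scale1r trmx_mul map_mxM trmxCK !mulmxA.
apply: synth_mul => //; apply: synth_mul; first exact: synth_adj.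
by apply: synth_dgate => x; case: ifP; rewrite ?normr1.
Qed.

Lemma synth_all (U : qop R Q) : U \is unitarymx -> synth (unitary_cost #|Q|) U.
Proof.
move=> uU; set P := spectralmx U; set d := spectral_diag U.
have uP : P \is unitarymx := spectral_unitarymx U.
have PP := unitary_adjK uP.
have PP' := unitarymxP uP.
have UE : U = P ^t* *m diag_mx d *m P.
  rewrite -(invmx_unitary uP); apply/orthomx_spectralP/normalmxP.
  by rewrite (unitarymxP uU) (unitary_adjK uU).
(* The diagonal matrix is the conjugate of [U] by the unitary [P], hence unitary. *)
have d1 k : `|d 0 k| = 1.
  have ud : diag_mx d \is unitarymx.
    have -> : diag_mx d = P *m U *m P ^t*.
      by rewrite UE !mulmxA PP' mul1mx -mulmxA PP' mulmx1.
    have uP' : P ^t* \is unitarymx by rewrite trmxC_unitary.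
    exact: (mul_unitarymx (mul_unitarymx uP uU) uP').
  move/unitarymxP: ud; rewrite tr_diag_mx map_diag_mx mulmx_diag.
  move/matrixP/(_ k k); rewrite !mxE eqxx !mulr1n => e.
  by apply/eqP; rewrite -(@pexpr_eq1 _ _ 2) // normCK e.
pose e k : qvec R Q := delta_mx k 0.
(* [D s] keeps the eigenvalues indexed by [s] and puts 1 elsewhere, so it grows from the identity to
   [diag_mx d] one eigenvector at a time. *)
pose D (s : seq 'I_#|{: W}|) := diag_mx (\row_k if k \in s then d 0 k else 1).
have step (s : seq 'I_#|{: W}|) :
    uniq s -> synth (size s * reflection_cost #|Q|) (P ^t* *m D s *m P).
  elim: s => [_|k s IHs /= /andP[ks us]].
    rewrite (_ : D [::] = 1%:M) ?mulmx1 ?PP; first by apply: synth_phase; rewrite normr1.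
    by rewrite -diag_const_mx; congr diag_mx; apply/rowP => k; rewrite !mxE.
  have -> : P ^t* *m D (k :: s) *m P = (P ^t* *m D [:: k] *m P) *m (P ^t* *m D s *m P).
    rewrite !mulmxA -(mulmxA _ P) PP' mulmx1 -(mulmxA _ (D [:: k])) mulmx_diag.
    congr (_ *m diag_mx _ *m _); apply/rowP => l; rewrite !mxE !inE.
    by case: eqVneq => [->|_]; rewrite ?(negbTE ks) ?mulr1 ?mul1r.
  rewrite mulSn; apply: synth_mul; last exact: IHs.
  (* [P ^t* *m e k] is the eigenvector for the eigenvalue [d 0 k]. *)
  have -> : P ^t* *m D [:: k] *m P =
      1%:M + (d 0 k - 1) *: ((P ^t* *m e k) *m (P ^t* *m e k) ^t*).
    have -> : D [:: k] = 1%:M + (d 0 k - 1) *: (e k *m (e k)^t*).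
      rewrite trmx_delta map_delta_mx mul_delta_mx; apply/matrixP => i j; rewrite !mxE inE.
      have [->|] := eqVneq i j; last first.
        move=> ij; rewrite !mulr0n add0r; case: eqVneq => [ik|]; last by rewrite mulr0.
        by rewrite -ik eq_sym (negbTE ij) mulr0.
      by case: eqP => [->|_] /=; rewrite !(mulr0, mulr1, mulr1n, addr0) // addrC subrK.
    rewrite mulmxDr mulmxDl mulmx1 PP -scalemxAr -scalemxAl; congr (_ + _ *: _).
    by rewrite trmx_mul map_mxM trmxCK !mulmxA.
  apply: synth_reflection => //.
  rewrite trmx_mul map_mxM trmxCK mulmxA -(mulmxA _ P) PP' mulmx1 trmx_delta map_delta_mx.
  by rewrite mul_delta_mx; apply/matrixP => i j; rewrite !ord1 !mxE !eqxx.
rewrite UE (_ : diag_mx d = D (enum 'I_#|{: W}|)); last first.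
  by congr diag_mx; apply/rowP => k; rewrite mxE mem_enum.
have sE : size (enum 'I_#|{: W}|) = (2 ^ #|Q|)%N.
  by rewrite -cardE card_ord card_ffun card_ord.
by rewrite /unitary_cost -sE; apply: step; apply: enum_uniq.
Qed.

End StatePreparation.

(** * Gates on a subset of the qubits *)

Section Extension.
Context (R : realType) (Q : finType) (S : {set Q}).
Local Notation T := {q | q \in S}.
Implicit Types (x y : {ffun Q -> 'I_2}) (w : {ffun T -> 'I_2}).

Lemma entry_extend (U : qop R T) x y :
  entry (extend U) x y =
  if agree_off S x y then entry U (restrict_bits S x) (restrict_bits S y) else 0.
Proof. by rewrite /entry mxE !enum_rankK. Qed.

Definition glue x w : {ffun Q -> 'I_2} :=
  [ffun q => if insub q is Some k then w k else x q].

Lemma restrict_glue x w : restrict_bits S (glue x w) = w.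
Proof. by apply/ffunP => k; rewrite !ffunE valK. Qed.

Lemma agree_off_glue x w : agree_off S x (glue x w).
Proof. by apply/agree_offP => q qS; rewrite ffunE insubN. Qed.

Lemma glue_restrict x y : agree_off S x y -> glue x (restrict_bits S y) = y.
Proof.
move=> /agree_offP xy; apply/ffunP => q; rewrite ffunE.
by case: insubP => [k _ <-|/xy //]; rewrite ffunE.
Qed.

Lemma restrict_bits_inj x y :
  agree_off S x y -> restrict_bits S x = restrict_bits S y -> x = y.
Proof.
by move=> xy e; rewrite -(glue_restrict xy) -e glue_restrict // agree_off_refl.
Qed.

(** Only intermediate strings that agree with [x] off [S] contribute, and [glue x] parametrizes them
    by strings on [S]. *)
Lemma extend_mul (U V : qop R T) : extend U *m extend V = extend (U *m V).
Proof.
apply: qopP => x y; rewrite entry_mul entry_extend.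
transitivity (\sum_(z | agree_off S x z) if agree_off S x y
   then entry U (restrict_bits S x) (restrict_bits S z) *
        entry V (restrict_bits S z) (restrict_bits S y) else 0).
  rewrite [RHS]big_mkcond; apply: eq_bigr => z _; rewrite !entry_extend.
  have [xz|_] := boolP (agree_off S x z); last by rewrite mul0r.
  rewrite (agree_off_sym _ z y) (agree_off_trans y xz).
  by case: ifP; rewrite ?mulr0.
rewrite (reindex_onto (glue x) (restrict_bits S)) /=; last exact: glue_restrict.
under eq_bigl do rewrite agree_off_glue restrict_glue eqxx.
case: ifP => _; last by rewrite big1.
by rewrite entry_mul; apply: eq_bigr => w _; rewrite restrict_glue.
Qed.

Lemma extend_scalar (z : R[i]) : extend (z%:M : qop R T) = z%:M.
Proof.
apply: qopP => x y; rewrite entry_extend {1}/entry mxE (inj_eq enum_rank_inj).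
rewrite /entry mxE (inj_eq enum_rank_inj).
have [->|xy] := eqVneq x y; first by rewrite agree_off_refl eqxx.
case: ifP => // axy; case: eqP => // /(restrict_bits_inj axy) xE.
by rewrite xE eqxx in xy.
Qed.

Lemma extend_on_qubit (q : T) (V : 'M[R[i]]_2) :
  extend (on_qubit q V) = on_qubit (val q) V.
Proof.
apply: qopP => x y; rewrite entry_extend !on_qubitE !entry_mux !ffunE.
rewrite [RHS](_ : _ = if agree_off S x y && agree_off [set q] (restrict_bits S x)
    (restrict_bits S y) then V (x (val q)) (y (val q)) else 0).
  by case: (agree_off S x y).
congr (if _ then _ else _).
apply/agree_offP/andP => [h|[/agree_offP xy /agree_offP h] k].
  split; apply/agree_offP => k.
    by move=> kS; apply: h; rewrite inE; apply: contraNneq kS => ->; apply: valP.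
  by rewrite inE !ffunE => kq; apply: h; rewrite inE.
rewrite inE => kq; have [kS|] := boolP (k \in S); last exact: xy.
have := h (exist _ k kS); rewrite !ffunE inE; apply.
by rewrite -val_eqE.
Qed.

Lemma extend_CNOT (c t : T) : c != t ->
  extend (CNOT R c t) = CNOT R (val c) (val t).
Proof.
move=> ct; apply: qopP => x y; rewrite entry_extend !entry_CNOT.
rewrite [LHS](_ : _ = (agree_off S x y &&
  (restrict_bits S x == cnot_bits c t (restrict_bits S y)))%:R); last by case: ifP.
congr (_%:R); congr nat_of_bool; apply/andP/eqP => [[/agree_offP xy /eqP rxy]|->].
  apply/ffunP => k; have [kS|kS] := boolP (k \in S).
    move/ffunP: rxy => /(_ (exist _ k kS)); rewrite !ffunE /= => ->.
    by rewrite -val_eqE.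
  rewrite ffunE xy //; case: eqP => // kt; by rewrite kt (valP t) in kS.
split; last by apply/eqP/ffunP => k; rewrite !ffunE val_eqE.
apply/agree_offP => k kS; rewrite ffunE; case: eqP => // kt.
by rewrite kt (valP t) in kS.
Qed.

End Extension.

(** * Euler decomposition of single-qubit unitaries *)

Section SingleQubit.
Context (R : realType).
Local Notation C := R[i].

(** [l] is the determinant; orthonormality of the rows expresses the second row through the
    first. *)
Lemma unitary2P (K : numClosedFieldType) (V : 'M[K]_2) : V \is unitarymx ->
  exists2 l, `|l| = 1 & V 1 1 = l * (V 0 0)^* /\ V 1 0 = - l * (V 0 1)^*.
Proof.
move=> /unitarymxP uV.
have h i j := congr1 (fun M : 'M[K]_2 => M i j) uV.
have := h 0 0; have := h 1 0; have := h 1 1.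
rewrite !mulmx2E !mxE /= !mulr1n !mulr0n.
move: (V 0 0) (V 0 1) (V 1 0) (V 1 1) => a b c d h11 h10 h00.
pose l := a * d - b * c.
have dE : d = l * a^*.
  have -> : l * a^* = d * (a * a^* + b * b^*) - b * (c * a^* + d * b^*) by rewrite /l; ring.
  by rewrite h00 h10 mulr1 mulr0 subr0.
have cE : c = - l * b^*.
  have -> : - l * b^* = c * (a * a^* + b * b^*) - a * (c * a^* + d * b^*) by rewrite /l; ring.
  by rewrite h00 h10 mulr1 mulr0 subr0.
exists l => //; apply/eqP; rewrite -(@pexpr_eq1 _ _ 2) // normCK.
move: h11; rewrite {1}cE {1}cE dE !rmorphM !rmorphN /= !conjCK => <-.
have -> : l * l^* = l * l^* * (a * a^* + b * b^*) by rewrite h00 mulr1.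
by apply/eqP; ring.
Qed.

(* The sign e makes up for th / 2 ranging over half of the circle only. *)
Lemma half_angle (c s : R) : c ^+ 2 + s ^+ 2 = 1 ->
  exists th e : R, [/\ 0 <= th < 2 * pi, `|e| = 1,
    cos (th / 2) = e * c & sin (th / 2) = e * s].
Proof.
(* For [s] = 0, [c] is 1 or -1, and the angle 0 with sign [c] works. *)
move=> cs1; have [s0|s0] := eqVneq s 0.
  exists 0, c; rewrite mul0r cos0 sin0 s0 mulr0 lexx mulr_gt0 ?pi_gt0 //.
  have c2 : c ^+ 2 = 1 by rewrite -cs1 s0 expr0n addr0.
  split => //.
  by apply/eqP; rewrite -(@pexpr_eq1 _ _ 2) // -normrX c2 normr1.
(* This sign makes the sine positive, as required of an [acos]; the cosine then exceeds -1, which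
   keeps the doubled angle strictly below 2 pi. *)
pose e := Num.sg s.
have e2 : e ^+ 2 = 1 by rewrite sqr_sg s0.
have es_gt0 : 0 < e * s by rewrite -normrEsg normr_gt0.
have ec1 : (e * c) ^+ 2 < 1.
  by rewrite exprMn e2 mul1r -cs1 ltrDl exprn_even_gt0.
have /andP[ec_gt ec_lt] : -1 < e * c < 1.
  by rewrite -ltr_norml -(ltr_sqr (_ : _ \is Num.nneg)) ?nnegrE // ?real_normK ?num_real // expr1n.
exists (acos (e * c) * 2), e; rewrite mulfK ?pnatr_eq0 //; split.
- rewrite mulr_ge0 ?acos_ge0 ?ltW //= mulrC ltr_pM2l //.
  by apply: acos_ltpi; rewrite ec_gt ltW.
- by rewrite normr_sg s0.
- by rewrite acosK // in_itv /= !ltW.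
rewrite sin_acos ?ltW //.
have -> : 1 - (e * c) ^+ 2 = (e * s) ^+ 2.
  by rewrite !exprMn e2 !mul1r -cs1 addrAC subrr add0r.
by rewrite sqrtr_sqr ger0_norm // ltW.
Qed.

End SingleQubit.

Section Euler.
Context (R : realType).
Implicit Types (a b z : R[i]) (c s th : R).
Local Notation H := (Hadamard R).

Lemma HadamardE i j : H i j = ((Num.sqrt 2)^-1)%:C * (-1) ^+ (i * j).
Proof. by rewrite !mxE. Qed.

Lemma sqr_invsqrt2 : ((Num.sqrt 2)^-1)%:C * ((Num.sqrt 2)^-1)%:C * 2 = 1 :> R[i].
Proof.
rewrite -[X in _ * X = _](rmorph_nat (real_complex R) 2) -!rmorphM.
by rewrite -invfM -expr2 sqr_sqrtr // mulVf ?pnatr_eq0 // rmorph1.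
Qed.

Lemma Hadamard_conj (A : 'M[R[i]]_2) : H *m A *m H =
  \matrix_(j, k) ((A 0 0 + (-1) ^+ k * A 0 1 + (-1) ^+ j * A 1 0
    + (-1) ^+ (j + k) * A 1 1) / 2).
Proof.
have e : 2^-1 = ((Num.sqrt 2)^-1)%:C * ((Num.sqrt 2)^-1)%:C :> R[i].
  by apply: (mulIf (_ : 2 != 0)); rewrite ?pnatr_eq0 // sqr_invsqrt2 mulVf ?pnatr_eq0.
apply/matrixP => j k; rewrite !mulmx2E mxE !HadamardE e exprD; move: (_%:C) => h.
rewrite !muln0 !mul0n !muln1 !mul1n expr0; ring.
Qed.

Lemma HadamardK : H *m H = 1%:M.
Proof.
rewrite -[X in X *m _]mulmx1 Hadamard_conj.
have e2 : (1 + 1) / 2 = 1 :> R[i] by rewrite -mulr2n divff // pnatr_eq0.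
by apply: mx2P; rewrite !mxE /= ?mulr1n ?mulr0n ?mulr0 ?addr0 ?expr0 ?mul1r ?e2 //
  ?expr1 ?mulN1r ?subrr ?mul0r // sqrrN expr1n mul1r.
Qed.

(** The x-rotation whose half angle has cosine [c] and sine [s], kept algebraic until angles are
    chosen. *)
Definition xrot c s : 'M[R[i]]_2 :=
  \matrix_(j, k) if j == k then c%:C else - ('i * s%:C).

(* diag(a, a^* ), that is Rz up to the parametrization. *)
Definition zrot a : 'M[R[i]]_2 :=
  \matrix_(j, k) if j == k then twist j a else 0.

Lemma Rx_xrot th c s (e : R) :
  cos (th / 2) = e * c -> sin (th / 2) = e * s -> Rx th = e%:C *: xrot c s.
Proof.
move=> cE sE; rewrite RxE cE sE !rmorphM complexiE; apply: mx2P; rewrite !mxE /=; ring.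
Qed.

Lemma conjC_real (c : R) : (c%:C)^* = c%:C :> R[i].
Proof. by apply/conj_Creal/complex_realP; exists c. Qed.

(** Conjugation by H turns Pauli X into Pauli Z, hence an x-rotation into a z-rotation. *)
Lemma Hadamard_xrot c s : H *m xrot c s *m H = zrot (c%:C - 'i * s%:C).
Proof.
have n2 : 2 != 0 :> R[i] by rewrite pnatr_eq0.
rewrite Hadamard_conj; apply: mx2P; rewrite !mxE /= ?twist0 ?twist1
  ?rmorphB ?rmorphM /= ?conjCi ?conjC_real; field => //.
Qed.

Lemma Rx0 : Rx 0 = 1%:M :> 'M[R[i]]_2.
Proof. by rewrite RxE mul0r cos0 sin0 rmorph0 rmorph1 scale0r addr0 scale1r. Qed.

Lemma level1_0 : level1 (fun=> 0 : R) = 1%:M.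
Proof. by rewrite /level1 !Rx0 !mulmx1 HadamardK mul1mx HadamardK. Qed.

Lemma unimodular_circle a : `|a| = 1 ->
  exists c s, c ^+ 2 + s ^+ 2 = 1 /\ a = c%:C - 'i * s%:C.
Proof.
move=> a1; exists (complex.Re a), (- complex.Im a); split.
  by apply: complexI; rewrite sqrrN add_Re2_Im2 a1 expr1n rmorph1.
by rewrite rmorphN mulrN opprK -complexiE -complexE.
Qed.

(** Divide [V] by a square root [m] of its determinant and write the first row as c u, s v with c, s
    moduli and u, v phases. Matching it requires a b = u and a b^* = i v, so a^2 = i u v and b = u /
    a; [unitary2P] settles the second row. *)
Lemma Euler_angles (V : 'M[R[i]]_2) : V \is unitarymx ->
  exists m a b c s, [/\ `|m| = 1, `|a| = 1, `|b| = 1, c ^+ 2 + s ^+ 2 = 1 &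
    V = m *: (zrot a *m xrot c s *m zrot b)].
Proof.
move=> uV; have [l l1 [V11 V10]] := unitary2P uV.
set m := sqrtC l; have m1 : `|m| = 1 by apply: norm1_sqrtC.
have m2 : m ^+ 2 = l by rewrite sqrtCK.
have m0 := norm1_neq0 m1.
have phase (z : R[i]) : exists2 u, `|u| = 1 & z = (complex.Re `|z|)%:C * u.
  rewrite RRe_real ?normr_real //.
  have [->|z0] := eqVneq z 0; first by exists 1; rewrite ?normr1 // normr0 mul0r.
  exists (z / `|z|); last by rewrite mulrC divfK // normr_eq0.
  by rewrite normrM normfV normr_id divff // normr_eq0.
have [u u1 uE] := phase (V 0 0 / m); have [v v1 vE] := phase (V 0 1 / m).
set c := complex.Re _ in uE; set s := complex.Re _ in vE.
have V00 : V 0 0 = c%:C * u * m by rewrite -uE divfK.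
have V01 : V 0 1 = s%:C * v * m by rewrite -vE divfK.
set a := sqrtC ('i * (u * v)).
have a1 : `|a| = 1 by rewrite norm1_sqrtC // !normrM normCi u1 v1 !mulr1.
have a2 : a ^+ 2 = 'i * (u * v) by rewrite sqrtCK.
have a0 := norm1_neq0 a1; have u0 := norm1_neq0 u1.
set b := u / a.
have b1 : `|b| = 1 by rewrite normrM normfV u1 a1 divr1.
have ii := sqrCi R[i].
exists m, a, b, c, s; split => //.
  apply: complexI; rewrite rmorphD !rmorphXn rmorph1 /=.
  rewrite !RRe_real ?normr_real // !normf_div m1 !divr1.
  have /unitarymxP/matrixP/(_ 0 0) := uV.
  by rewrite mulmx2E !mxE /= => e; rewrite !normCK e.
have ab : a * b = u by rewrite mulrC divfK.
have abJ : a * b^* = 'i * v.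
  by rewrite (norm1_conj_inv b1) invf_div mulrA -expr2 a2; field.
have abC : a^* * b^* = u^* by rewrite -rmorphM ab.
have aCb : a^* * b = - 'i * v^*.
  by rewrite -[b]conjCK -rmorphM abJ rmorphM /= conjCi.
have mm : m^* * m = 1 by apply: norm1_conj.
apply: mx2P; rewrite [RHS]mxE !mulmx2E !mxE /= ?twist0 ?twist1 !(mul0r, mulr0, addr0, add0r).
- by rewrite V00 -ab; ring.
- transitivity (m * - ('i * s%:C * (a * b^*))); last by ring.
  by rewrite V01 abJ; ring: ii.
- transitivity (m * - ('i * s%:C * (a^* * b))); last by ring.
  rewrite V10 V01 aCb -m2 !rmorphM /= conjC_real.
  transitivity (- m * (m^* * m) * s%:C * v^*); first by ring.
  by rewrite mm; ring: ii.
- transitivity (m * (c%:C * (a^* * b^*))); last by ring.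
  rewrite V11 V00 abC -m2 !rmorphM /= conjC_real.
  transitivity (m * (m^* * m) * c%:C * u^*); first by ring.
  by rewrite mm; ring.
Qed.

End Euler.

(** * Operators reached by layers of the variational circuit *)

Section Ansatz.
Context (R : realType).
Implicit Types (z : R[i]).
Local Notation H := (Hadamard R).

Lemma valid_angle0 : (0 : R) <= 0 < 2 * @pi R.
Proof. by rewrite lexx mulr_gt0 ?pi_gt0. Qed.

Lemma mulmxZ3 (K : comPzRingType) m (x y z : K) (A B C : 'M[K]_m) :
  (x *: A) *m (y *: B) *m (z *: C) = (x * y * z) *: (A *m B *m C).
Proof.
rewrite -!scalemxAl -!scalemxAr -?scalemxAl !scalerA; congr (_ *: _); ring.
Qed.

Lemma Hadamard_Rx (th c s e : R) :
  cos (th / 2) = e * c -> sin (th / 2) = e * s ->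
  H *m Rx th *m H = e%:C *: zrot (c%:C - 'i * s%:C).
Proof.
move=> cE sE; rewrite (Rx_xrot cE sE) -Hadamard_xrot.
by have := mulmxZ3 1 e%:C 1 H (xrot c s) H; rewrite !scale1r mul1r mulr1.
Qed.

Lemma level1E (p : 'I_3 -> R) :
  level1 p = (H *m Rx (p 0) *m H) *m Rx (p 1) *m (H *m Rx (p 2) *m H).
Proof.
rewrite /level1; move: H (Rx _) (Rx _) (Rx _) => h A B C.
by rewrite !mulmxA.
Qed.

(** The scalar [z] collects the signs of the three half angles and the inverse of the Euler phase
    [m]. *)
Lemma level1_surj (V : 'M[R[i]]_2) : V \is unitarymx ->
  exists p z, [/\ forall k, 0 <= p k < 2 * pi, `|z| = 1 & level1 p = z *: V].
Proof.
move=> /Euler_angles[m [a [b [c [s [m1 a1 b1 cs1 ->]]]]]].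
have [ca [sa [/half_angle[ta [ea [tar ea1 cta sta]]] ->]]] := unimodular_circle a1.
have [cb [sb [/half_angle[tb [eb [tbr eb1 ctb stb]]] ->]]] := unimodular_circle b1.
have [t [e [tr e1 ct st]]] := half_angle cs1.
have norm1 (x : R) : `|x| = 1 -> `|x%:C| = 1 :> R[i].
  by move=> x1; rewrite normc_def /= expr0n addr0 sqrtr_sqr x1.
exists (fun k : 'I_3 => [:: ta; t; tb]`_k), ((ea * e * eb)%:C / m); split.
- by case=> -[|[|[|]]].
- by rewrite normrM normfV m1 divr1 norm1 // !normrM ea1 e1 eb1 !mulr1.
set p := fun k : 'I_3 => _.
have Ea := Hadamard_Rx cta sta; have Eb := Hadamard_Rx ctb stb.
have E : level1 p = _ :=
  etrans (level1E p) (congr2 mulmx (congr2 mulmx Ea (Rx_xrot ct st)) Eb).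
rewrite E mulmxZ3.
by rewrite scalerA (divfK (norm1_neq0 m1)) !rmorphM.
Qed.

Section Register.
Context (n : nat).
Implicit Types (A B : qop R 'I_n) (i j : 'I_n).

Lemma first_qubit_neq i : (0 < i)%N -> first_qubit i != i.
Proof. by rewrite -val_eqE /= eq_sym lt0n. Qed.

Lemma level2_0 i : (0 < i)%N -> level2 i (fun=> fun=> 0 : R) = 1%:M.
Proof.
move=> i0; rewrite /level2 level1_0 !on_qubit1 !mulmx1.
exact/CNOTK/first_qubit_neq.
Qed.

Lemma prod_single (T : pzSemiRingType) (I : eqType) (r : seq I) (P : pred I) (i : I) (x : T) :
  uniq r -> i \in r -> P i -> \prod_(j <- r | P j) (if j == i then x else 1) = x.
Proof.
move=> + + Pi; elim: r => // k r IHr /= /andP[kr ur]; rewrite inE big_cons.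
have [ki|ki] := eqVneq k i.
  rewrite ki Pi big1_seq ?mulr1 // => j /andP[_ jr].
  by case: eqP => // ji; rewrite ki -ji jr in kr.
by move=> /= ir; rewrite IHr // mul1r if_same.
Qed.

(** The factor [z] is invisible on pure states. *)
Definition realizes d A := exists (theta : 'I_d -> 'I_n -> 'I_4 -> 'I_3 -> R) z,
  [/\ forall l i k a, 0 <= theta l i k a < 2 * pi, `|z| = 1 & ansatz theta = z *: A].

(** Zero parameters give the identity at every depth [d], which also lets a realization be padded to
    more layers. *)
Lemma realizes_phase d z : `|z| = 1 -> realizes d z%:M.
Proof.
move=> z1; exists (fun _ _ _ _ => 0), z^-1; split=> [*||].
- exact: valid_angle0.
- by rewrite normfV z1 invr1.
rewrite -mul_scalar_mx -scalar_mxM mulVf ?norm1_neq0 //.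
rewrite /ansatz big1 // => l _; rewrite /layer big1 // => i; exact: level2_0.
Qed.

Lemma realizes_mul d e A B :
  realizes d A -> realizes e B -> realizes (d + e) (A *m B).
Proof.
move=> [ta [z [ra z1 Az]]] [tb [w [rb w1 Bw]]].
exists (fun l => match fintype.split l with inl l => ta l | inr l => tb l end), (z * w).
split; last 1 first.
- rewrite /ansatz big_split_ord /=.
  under eq_bigr do rewrite -/(unsplit (inl _)) unsplitK.
  under [X in _ * X]eq_bigr do rewrite -/(unsplit (inr _)) unsplitK.
  have := congr2 (@mulmx R[i] _ _ _) Az Bw.
  by rewrite -scalemxAl -scalemxAr scalerA.
- by move=> l; case: (fintype.split l).
- by rewrite normrM z1 w1 mulr1.
Qed.

Lemma realizes_leq d e A : (d <= e)%N -> realizes d A -> realizes e A.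
Proof.
move=> de rA; rewrite -(subnKC de) -[A]mulmx1; apply: realizes_mul => //.
by apply: realizes_phase; rewrite normr1.
Qed.

(** One layer suffices: its other blocks get zero parameters and become the identity. *)
Lemma realizes_block i (U V U' V' : 'M[R[i]]_2) : (0 < i)%N ->
  U \is unitarymx -> V \is unitarymx -> U' \is unitarymx -> V' \is unitarymx ->
  let o := first_qubit i in
  realizes 1 (CNOT R o i *m (on_qubit o U *m on_qubit i V) *m
              CNOT R o i *m (on_qubit o U' *m on_qubit i V')).
Proof.
move=> i0 /level1_surj[p2 [z2 [r2 n2 e2]]] /level1_surj[p3 [z3 [r3 n3 e3]]].
move=> /level1_surj[p0 [z0 [r0 n0 e0]]] /level1_surj[p1 [z1 [r1 n1 e1]]] o.
pose p (k : 'I_4) : 'I_3 -> R := nth (fun=> 0) [:: p0; p1; p2; p3] k.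
exists (fun _ j => if j == i then p else fun _ _ => 0), (z2 * z3 * (z0 * z1)); split.
- move=> l j k a; case: ifP => _; last exact: valid_angle0.
  by case: k => -[|[|[|[|]]]] //= _.
- by rewrite !normrM n0 n1 n2 n3 !mulr1.
rewrite /ansatz big_ord1 /layer.
rewrite (eq_bigr (fun j => if j == i then level2 i p else 1)); last first.
  by move=> j j0; case: eqP => [->//|_]; apply: level2_0.
rewrite prod_single ?rev_uniq ?enum_uniq ?mem_rev ?mem_enum //.
rewrite /level2 /p /= -/o e0 e1 e2 e3 !on_qubitZ.
by rewrite -!(scalemxAl, scalemxAr) !scalerA; congr (_ *: _); ring.
Qed.

Lemma unitary1 m : (1%:M : 'M[R[i]]_m) \is unitarymx.
Proof. by apply/unitarymxP; rewrite trmx1 map_mx1 mulmx1. Qed.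

Lemma realizes_local i (U V : 'M[R[i]]_2) : (0 < i)%N ->
  U \is unitarymx -> V \is unitarymx ->
  realizes 1 (on_qubit (first_qubit i) U *m on_qubit i V).
Proof.
move=> i0 uU uV.
have := realizes_block i0 (unitary1 2) (unitary1 2) uU uV.
by rewrite /= !on_qubit1 !mulmx1 CNOTK ?mul1mx // first_qubit_neq.
Qed.

End Register.
End Ansatz.

(** * CNOT gates through controlled-Z gates *)

Section Entanglers.
Context (R : realType) (Q : finType).
Implicit Types (x : {ffun Q -> 'I_2}) (c t q : Q).
Local Notation H := (Hadamard R).

Definition phase2 (z : R[i]) : 'M[R[i]]_2 :=
  diag_mx (\row_a (if a == 0 then 1 else z)).

Lemma phase2_unitary z : `|z| = 1 -> phase2 z \is unitarymx.
Proof.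
by move=> z1; apply: diag_unitary => a; rewrite mxE; case: ifP; rewrite ?normr1.
Qed.

Lemma on_qubit_phase2 q z :
  on_qubit q (phase2 z) = dgate (fun x => if x q == 0 then 1 else z).
Proof.
rewrite (dgate_mux q) on_qubitE; congr mux; apply/funext => x.
by congr diag_mx; apply/rowP => a; rewrite !mxE updK.
Qed.

Definition cz x c t : R[i] := if (x c == 0) || (x t == 0) then 1 else -1.

(* (-1)^(x y) = i^x i^y (-i)^(x + y mod 2), so one conjugation by CNOT is enough
   and CZ takes a single entangling block. *)
Lemma dgate_cz c t : c != t -> dgate (fun x => cz x c t) =
  on_qubit c (phase2 'i) *m on_qubit t (phase2 'i) *m
  (CNOT R c t *m on_qubit t (phase2 (- 'i)) *m CNOT R c t).
Proof.
move=> ct; rewrite !on_qubit_phase2 CNOT_dgate // !dgate_mul; apply: eq_dgate => x.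
rewrite /cz /= ffunE eqxx; have ii := sqrCi R[i].
by case: (ord2P (x c)) => ->; case: (ord2P (x t)) => -> /=; ring: ii.
Qed.

Lemma Hadamard_phase2N1 : H *m phase2 (-1) *m H = PauliX R.
Proof.
have n2 : 2 != 0 :> R[i] by rewrite pnatr_eq0.
by rewrite Hadamard_conj; apply: mx2P; rewrite !mxE /=; field.
Qed.

Lemma CNOT_mux c t : c != t ->
  CNOT R c t = mux t (fun x => if x c == 0 then 1%:M else PauliX R).
Proof.
move=> ct; apply: qopP => x y; rewrite entry_CNOT entry_mux agree_off1E.
have [xy|nxy] := eqVneq y (upd x t (y t)); last first.
  case: eqP => // xE; case/eqP: nxy; apply/ffunP => q; rewrite ffunE.
  by case: eqVneq => [->//|qt]; rewrite xE ffunE (negbTE qt).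
have xcy : x c = y c by rewrite xy upd_neq.
have -> : (x == cnot_bits c t y) = (x t == y t + y c).
  apply/eqP/eqP => [->|xt]; first by rewrite ffunE eqxx.
  apply/ffunP => q; rewrite ffunE; case: eqVneq => [->//|qt].
  by rewrite xy upd_neq.
rewrite xcy; case: (ord2P (y c)) => ->; rewrite /= ?addr0 !mxE //.
by case: (ord2P (x t)) => ->; case: (ord2P (y t)) => ->.
Qed.

(** For each value of bit [c] the identity concerns [t] alone: H H = 1 or H Z H = X. *)
Lemma CNOT_cz c t : c != t ->
  CNOT R c t = on_qubit t H *m dgate (fun x => cz x c t) *m on_qubit t H.
Proof.
move=> ct; rewrite CNOT_mux // (dgate_mux t) !on_qubitE.
rewrite mux_mul => [|x a]; last first.
  by congr diag_mx; apply/rowP => k; rewrite !mxE upd_upd.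
rewrite mux_mul //; congr mux; apply/funext => x.
have -> : diag_mx (\row_a cz (upd x t a) c t) = phase2 (if x c == 0 then 1 else -1).
  congr diag_mx; apply/rowP => a; rewrite !mxE /cz updK upd_neq //.
  by case: (x c == 0); case: (a == 0).
case: ifP => _; last by rewrite Hadamard_phase2N1.
rewrite (_ : phase2 1 = 1%:M) ?mulmx1 ?HadamardK //.
by rewrite -diag_const_mx; congr diag_mx; apply/rowP => a; rewrite !mxE if_same.
Qed.

Lemma czC c t x : cz x c t = cz x t c.
Proof. by rewrite /cz orbC. Qed.

Lemma bit_addbb (a : 'I_2) : a + a = 0.
Proof. by case: (ord2P a) => ->; apply/val_inj. Qed.

(* The ansatz has no CNOT between two qubits both different from the first one. *)
Lemma CNOT_relay (o c t : Q) : o != c -> o != t -> c != t ->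
  CNOT R c t = CNOT R o t *m (CNOT R c o *m (CNOT R o t *m CNOT R c o)).
Proof.
move=> oc ot ct; have co : c != o by rewrite eq_sym.
apply: qopP => x y; rewrite !entry_CNOT_mul // !entry_CNOT.
rewrite -(inj_eq (inv_inj (cnot_bitsK ct))) -[in RHS](inj_eq (inv_inj (cnot_bitsK co))).
rewrite !cnot_bitsK //; congr (_%:R); congr nat_of_bool; congr (_ == _).
have to : t != o by rewrite eq_sym.
apply/ffunP => q; rewrite !ffunE !eqxx (negbTE ot) (negbTE to) (negbTE ct).
have [->|qo] := eqVneq q o; last first.
  by case: ifP => // _; rewrite addrA -[x t + _ + _]addrA bit_addbb addr0.
by rewrite (negbTE ot) (negbTE co) -addrA bit_addbb addr0.
Qed.

End Entanglers.

Arguments cz {R Q}.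

(** * Layer counts for elementary gates, gates and circuits *)

Section Universality.
Context (R : realType) (n : nat).
Implicit Types (A B : qop R 'I_n) (i j : 'I_n).
Local Notation H := (Hadamard R).

Lemma normNi : `|- 'i| = 1 :> R[i].
Proof. by rewrite normrN normCi. Qed.

Lemma realizes_qubit q (V : 'M[R[i]]_2) : (2 <= n)%N -> V \is unitarymx ->
  realizes 1 (on_qubit q V : qop R 'I_n).
Proof.
move=> n2 uV; have [q0|q0] := posnP q; last first.
  by have := realizes_local q0 (unitary1 R 2) uV; rewrite on_qubit1 mul1mx.
(* The first qubit belongs to every block; the block of the second qubit, which exists since n is at
   least 2, is used with the identity on that qubit. *)
have := @realizes_local R n (Ordinal n2) V 1%:M isT uV (unitary1 R 2).
by rewrite on_qubit1 mulmx1 (_ : first_qubit _ = q) //; apply/val_inj.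
Qed.

(** One layer for the left H, one for each of the two phase gates, and one block for the conjugated
    phase, whose initial local gates absorb the right H. *)
Lemma realizes_cz_H (i q : 'I_n) : (2 <= n)%N -> (0 < i)%N ->
  q = first_qubit i \/ q = i ->
  realizes 4 (on_qubit q H *m dgate (fun x => cz x (first_qubit i) i) *m on_qubit q H).
Proof.
move=> n2 i0 qP; set o := first_qubit i; have oi : o != i := first_qubit_neq i0.
have uI := phase2_unitary (normCi R[i]); have uN := phase2_unitary normNi.
have uH := Hadamard_unitary R.
rewrite dgate_cz // !mulmxA -(mulmxA (on_qubit q H)) -!mulmxA.
apply: (@realizes_mul _ _ 1 3); first exact: (realizes_qubit _ n2 uH).
apply: (@realizes_mul _ _ 1 2); first exact: (realizes_qubit _ n2 uI).
apply: (@realizes_mul _ _ 1 1); first exact: (realizes_qubit _ n2 uI).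
have u1 := unitary1 R 2.
have := realizes_block i0 u1 uN; rewrite -/o /= on_qubit1 mul1mx.
case: qP => ->.
  by move=> /(_ _ _ uH u1); rewrite on_qubit1 mulmx1 -!mulmxA.
by move=> /(_ _ _ u1 uH); rewrite on_qubit1 mul1mx -!mulmxA.
Qed.

(** CZ is symmetric, so the position of the H gates decides which end is the target and both
    directions along a block cost 4 layers. Between two other qubits, [CNOT_relay] uses four such
    gates. *)
Lemma realizes_CNOT (c t : 'I_n) : (2 <= n)%N -> c != t -> realizes 16 (CNOT R c t).
Proof.
move=> n2; have from0 i : (0 < i)%N -> realizes 4 (CNOT R (first_qubit i) i).
  by move=> i0; rewrite CNOT_cz ?first_qubit_neq //; apply: realizes_cz_H => //; right.
have to0 i : (0 < i)%N -> realizes 4 (CNOT R i (first_qubit i)).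
  move=> i0; rewrite CNOT_cz; last by rewrite eq_sym first_qubit_neq.
  by under eq_dgate do rewrite czC; apply: realizes_cz_H => //; left.
have [c0|c0] := posnP c => ct.
  have -> : c = first_qubit t by apply/val_inj.
  apply: (@realizes_leq _ _ 4) => //; apply: from0.
  by rewrite lt0n -c0 eq_sym (inj_eq val_inj).
have [t0|t0] := posnP t.
  have -> : t = first_qubit c by apply/val_inj.
  exact: (@realizes_leq _ _ 4) (to0 _ c0).
have oE : first_qubit c = first_qubit t by apply/val_inj.
have ot : first_qubit c != t by rewrite oE first_qubit_neq.
rewrite (CNOT_relay R (first_qubit_neq c0) ot ct).
have r1 := to0 _ c0; have r2 := from0 _ t0; rewrite -oE in r2.
apply: (@realizes_mul _ _ 4 12) => //; apply: (@realizes_mul _ _ 4 8) => //.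
exact: (@realizes_mul _ _ 4 4).
Qed.

Lemma realizes_synth (S : {set 'I_n}) k (U : qop R {q | q \in S}) :
  (2 <= n)%N -> synth k U -> realizes (16 * k) (extend U).
Proof.
move=> n2; elim=> [{}k z z1|q V uV|c t ct|{}k l {}U V _ rU _ rV].
- by rewrite extend_scalar; apply: realizes_phase.
- rewrite extend_on_qubit; apply: (@realizes_leq _ _ 1) => //.
  exact: realizes_qubit.
- by rewrite extend_CNOT //; apply: realizes_CNOT.
- by rewrite -extend_mul mulnDr; apply: realizes_mul.
Qed.

(** The sum is a bound common to all supports: [unitary_cost #|S|] is one of its terms, since [#|S|]
    is at most [b]. *)
Lemma realizes_gate b (G : qop R 'I_n) : (2 <= n)%N -> is_gate b G ->
  realizes (16 * \sum_(k < b.+1) unitary_cost k) G.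
Proof.
move=> n2 [S [Sb [U uU ->]]].
have := synth_all uU; rewrite card_sig => sU.
apply: realizes_leq (realizes_synth n2 sU); rewrite leq_mul2l /=.
by rewrite (bigD1 (Ordinal (_ : #|S| < b.+1)%N)) //= leq_addr.
Qed.

Lemma realizes_prod d (gs : seq (qop R 'I_n)) :
  (forall G, G \in gs -> realizes d G) -> realizes (size gs * d) (\prod_(G <- gs) G).
Proof.
elim: gs => [|G gs IHgs] rG.
  by rewrite big_nil; apply: (@realizes_phase R n _ 1); rewrite normr1.
rewrite big_cons mulSn; apply: realizes_mul; first by apply: rG; rewrite mem_head.
by apply: IHgs => G' G'gs; apply: rG; rewrite inE G'gs orbT.
Qed.

(** The phase left by the ansatz relates two representatives of the same ray. *)
Lemma realizes_state_map d (C : qop R 'I_n) (uC : C \is unitarymx) :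
  realizes d C -> exists2 f, hypothesis_space d f & f =1 state_map uC.
Proof.
move=> [theta [z [rt z1 tC]]].
exists (state_map (ansatz_unitary theta)); first by exists theta.
move=> x; rewrite -[x]reprK !state_map_pi; apply/eqmodP/asboolP.
exists z^-1; split; first by rewrite normfV z1 invr1.
by rewrite /= tC -scalemxAl scalerA mulVf ?norm1_neq0 // scale1r.
Qed.

End Universality.

Theorem theorem1 (R : realType) (b : nat) (c : R) (hb : (1 <= b)%N) (hc : 0 <= c) :
  exists2 M : R, 0 < M &
  forall n : nat, (2 <= n)%N ->
  forall (C : qop R 'I_n) (hC : is_circuit b c C),
  exists2 fh : pure_state R 'I_n -> pure_state R 'I_n,
    hypothesis_space `|Num.ceil (M * n%:R `^ c)|%N fh &
    forall x : pure_state R 'I_n, fh x = state_map (circuit_unitary hC) x.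
Proof.
(* The successor makes the constant positive. *)
pose K := (16 * \sum_(k < b.+1) unitary_cost k).+1.
exists K%:R => [|n n2 C hC]; first by rewrite ltr0n.
apply: realizes_state_map; move: hC => [gs [size_gs gates ->]].
apply: (@realizes_leq _ _ (size gs * K)).
  (* The number of layers, an absolute value of a ceiling, is at least K n^c, and the circuit has at
     most n^c gates. *)
  rewrite -(ler_nat R) natr_absz intr_norm natrM mulrC.
  apply: le_trans (le_trans (ceil_ge _) (ler_norm _)).
  by rewrite ler_wpM2l.
apply: realizes_prod => G /gates /(realizes_gate n2).
by apply: realizes_leq; rewrite /K leqnSn.
Qed.
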